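(* Let $\alpha\in(0,1)$, $T>0$, $N\ge1$ an integer, $\Delta t=T/N$, $t_k=k\Delta t$. For any function $u\in C([0,T];L^2(\Omega))$, with $u^k=u(t_k)$, and for every $1\le n\le N$, $$\sum_{k=1}^n d_{n-k+1}\left\langle L_k^\alpha u,\,D_ku\right\rangle\ \ge\ \frac{5\alpha\,\Delta t^{1-\alpha}}{12\,\Gamma(3-\alpha)}\sum_{k=1}^n d_{n-k+1}\|D_ku\|^2\ \ge\ 0,$$ where $D_ku=\dfrac{u^k-u^{k-1}}{\Delta t}$ for $k\ge1$.
   Context: $\Omega$ is a bounded domain (a periodic box in the paper); $\langle\cdot,\cdot\rangle$ and $\|\cdot\|$ are the $L^2(\Omega)$ inner product and norm. The L2 operator: for a sequence $(u^k)$, $$L_1^\alpha u=\frac{1}{\Gamma(2-\alpha)\Delta t^\alpha}(u^1-u^0),$$ and for $k\ge2$, $$L_k^\alpha u=\frac{1}{\Gamma(3-\alpha)\Delta t^\alpha}\Big\{\sum_{j=1}^{k-1}\big(a_ju^{k-j-1}+b_ju^{k-j}+c_ju^{k-j+1}\big)+\frac\alpha2u^{k-2}-2u^{k-1}+\frac{4-\alpha}{2}u^k\Big\},$$ where $a_j=-\frac32(2-\alpha)(j+1)^{1-\alpha}+\frac12(2-\alpha)j^{1-\alpha}+(j+1)^{2-\alpha}-j^{2-\alpha}$, $b_j=2(2-\alpha)(j+1)^{1-\alpha}-2(j+1)^{2-\alpha}+2j^{2-\alpha}$, $c_j=-\frac12(2-\alpha)\big((j+1)^{1-\alpha}+j^{1-\alpha}\big)+(j+1)^{2-\alpha}-j^{2-\alpha}$.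 The coefficients $d_j$ are $d_1=c_1+2-2\alpha$ and $d_j=c_j-a_{j-1}$ for $j\ge2$. Equivalently, for $k\ge2$ $$L_k^\alpha u=\frac{\Delta t^{1-\alpha}}{\Gamma(3-\alpha)}\Big\{\frac{3\alpha}{2}D_ku-\frac\alpha2D_{k-1}u+\sum_{j=1}^kd_jD_{k-j+1}u-c_kD_1u\Big\},$$ and $L_1^\alpha u=\frac{\Delta t^{1-\alpha}}{\Gamma(3-\alpha)}(2-\alpha)D_1u$. *)

(* Defs.v *)
From HB Require Import structures.
From mathcomp Require Import all_boot all_order all_algebra.
From mathcomp Require Import all_classical all_reals all_analysis.
From mathcomp Require Import measurable_realfun.

Set Implicit Arguments.
Unset Strict Implicit.
Unset Printing Implicit Defensive.

Import Order.TTheory GRing.Theory Num.Theory.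
Import numFieldNormedType.Exports.

Local Open Scope classical_set_scope.
Local Open Scope ring_scope.

Section tuple_cons_measure.
Context (R : realType) (m : nat).
Local Notation Rm := (measurableTypeR R).
Variable nu : {sigma_finite_measure set (m.-tuple Rm) -> \bar R}.

Let consp (x : Rm * m.-tuple Rm) : m.+1.-tuple Rm := [tuple of x.1 :: x.2].

Let measurable_consp : measurable_fun [set: Rm * m.-tuple Rm] consp.
Proof. exact: measurable_cons. Qed.

Definition tuple_cons_measure : set (m.+1.-tuple Rm) -> \bar R :=
  pushforward (@lebesgue_measure R \x nu)%E consp.

Let mpre A : measurable A -> measurable (consp @^-1` A).
Proof. by move=> mA; rewrite -[X in measurable X]setTI; exact: measurable_consp. Qed.

Let tcm0 : tuple_cons_measure set0 = 0%E.
Proof. exact: measure0. Qed.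

Let tcm_ge0 A : (0 <= tuple_cons_measure A)%E.
Proof. exact: measure_ge0. Qed.

Let tcm_sigma_additive : semi_sigma_additive tuple_cons_measure.
Proof.
move=> F mF tF mUF; rewrite /tuple_cons_measure /pushforward preimage_bigcup.
apply: measure_semi_sigma_additive.
- by move=> n; exact: mpre.
- apply/trivIsetP => /= i j _ _ ij; rewrite -preimage_setI.
  by move/trivIsetP : tF => /(_ _ _ _ _ ij) ->//; rewrite preimage_set0.
- by rewrite -preimage_bigcup; exact: mpre.
Qed.

HB.instance Definition _ := isMeasure.Build _ _ _ tuple_cons_measure
  tcm0 tcm_ge0 tcm_sigma_additive.

Let tcm_sigma_finite : sigma_finite setT tuple_cons_measure.
Proof.
pose lam : {sigma_finite_measure set Rm -> \bar R} := @lebesgue_measure R.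
have /sigma_finiteP[F [TF ndF Foo]] := sigma_finiteT lam.
have /sigma_finiteP[G [TG ndG Goo]] := sigma_finiteT nu.
pose unc (t : m.+1.-tuple Rm) : Rm * m.-tuple Rm := (thead t, [tuple of behead t]).
have munc : measurable_fun setT unc.
  apply/measurable_fun_pairP; split; first exact: measurable_tnth.
  exact: measurable_behead.
have uncK x : unc (consp x) = x.
  by case: x => x t; rewrite /unc /consp; congr pair; exact/val_inj.
exists (fun n => unc @^-1` (F n `*` G n)).
  apply/seteqP; split => // t _.
  have [k _ Fk] : (\bigcup_i F i) (unc t).1 by rewrite -TF.
  have [l _ Gl] : (\bigcup_i G i) (unc t).2 by rewrite -TG.
  exists (maxn k l) => //; split.
  - by move: Fk; exact/subsetPset/ndF/leq_maxl.
  - by move: Gl; exact/subsetPset/ndG/leq_maxr.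
move=> n; have [mF Fn] := Foo n; have [mG Gn] := Goo n; split.
  by rewrite -[X in measurable X]setTI; apply: munc => //; exact: measurableX.
rewrite /tuple_cons_measure /pushforward -comp_preimage.
rewrite (_ : unc \o consp = id); last exact/funext.
by rewrite product_measure1E// lte_mul_pinfty// ge0_fin_numE.
Qed.

HB.instance Definition _ := Measure_isSigmaFinite.Build _ _ _
  tuple_cons_measure tcm_sigma_finite.

End tuple_cons_measure.

Fixpoint lebesgue_tuple (R : realType) (m : nat) :
    {sigma_finite_measure set (m.-tuple (measurableTypeR R)) -> \bar R} :=
  match m with
  | 0 => \d_ [tuple]
  | n.+1 => tuple_cons_measure (lebesgue_tuple R n)
  end.

Definition borel_rV (R : realType) (m : nat) :=
  g_sigma_algebraType (@open 'rV[R]_m).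

Definition row_of_tuple (R : realType) (m : nat)
    (t : m.-tuple (measurableTypeR R)) : borel_rV R m :=
  (\row_i tnth t i : 'rV[R]_m).

Lemma measurable_row_of_tuple (R : realType) (m : nat) :
  measurable_fun setT (@row_of_tuple R m).
Proof.
apply: (@measurability _ _ _ (borel_rV R m) _ (@row_of_tuple R m)
  (@open 'rV[R]_m)) => //.
move=> _ [U oU <-].
rewrite setTI.
pose Q (qn : 'rV[rat]_m * nat) : set (m.-tuple (measurableTypeR R)) :=
  if `[< ball (map_mx (@ratr R) qn.1) (qn.2.+1%:R^-1) `<=` U >] then
  \bigcap_(i in [set: 'I_m]) ((@tnth _ _)^~ i @^-1`
     (ball (ratr (qn.1 ord0 i) : R) qn.2.+1%:R^-1)) else set0.
suff -> : (@row_of_tuple R m) @^-1` U = \bigcup_qn Q qn.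
  apply: countable_bigcupT_measurable => // -[q n].
  rewrite /Q /=; case: ifPn => // _.
  apply: fin_bigcap_measurable => // i _.
  rewrite -[X in measurable X]setTI; apply: measurable_tnth => //.
  exact: measurable_ball.
apply/seteqP; split => [t /= Ut|t [[q n] _]]; last first.
  rewrite /Q/=; case: ifPn => // /asboolP qU tq; apply: qU.
  split; first by rewrite invr_gt0.
  move=> i j; rewrite !mxE ord1.
  exact: tq.
have /nbhs_ballP[e /= e0 eU] : nbhs (\row_i tnth t i : 'rV[R]_m) U.
  exact: open_nbhs_nbhs.
pose n := Num.truncn (2 / e).
have n2 : n.+1%:R^-1 < e / 2 :> R.
  rewrite -(invrK (e / 2)) ltf_pV2 ?posrE ?invr_gt0 ?divr_gt0//.
  by rewrite invf_div truncnS_gt.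
have n0 : 0 < n.+1%:R^-1 :> R by rewrite invr_gt0.
have /choice[q hq] : forall i, exists q : rat,
    ball (ratr q : R) n.+1%:R^-1 (tnth t i).
  move=> i; have /rat_in_itvoo[q] : tnth t i - n.+1%:R^-1 < tnth t i + n.+1%:R^-1 :> R.
    by rewrite ltrBlDr -addrA ltrDl addr_gt0.
  rewrite in_itv/= => /andP[h1 h2]; exists q.
  by rewrite /ball/= ltr_distl h1.
exists (\row_i q i, n) => //; rewrite /Q/= ifT.
  by move=> i _ /=; rewrite mxE.
apply/asboolP => x [_ /= hx]; apply: eU; split => // i j.
have h1 : ball (tnth t j : R) (e / 2) (ratr (q j)).
  by apply: ball_sym; apply: le_ball (hq j); exact: ltW.
have h2 : ball (ratr (q j) : R) (e / 2) (x i j).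
  by have := hx i j; rewrite !mxE; apply: le_ball; exact: ltW.
by rewrite mxE (splitr e); exact: (ball_triangle h1 h2).
Qed.

Section lebesgue_rV.
Context (R : realType) (m : nat).

Definition lebesgue_rV : set (borel_rV R m) -> \bar R :=
  pushforward (lebesgue_tuple R m) (@row_of_tuple R m).

Let mpre (A : set (borel_rV R m)) : measurable A ->
  measurable (@row_of_tuple R m @^-1` A).
Proof.
by move=> mA; rewrite -[X in measurable X]setTI; exact: measurable_row_of_tuple.
Qed.

Let leb0 : lebesgue_rV set0 = 0%E.
Proof. by rewrite /lebesgue_rV /pushforward preimage_set0 measure0. Qed.

Let leb_ge0 A : (0 <= lebesgue_rV A)%E.
Proof. exact: (measure_ge0 (lebesgue_tuple R m)). Qed.

Let leb_sigma_additive : semi_sigma_additive lebesgue_rV.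
Proof.
move=> F mF tF mUF; rewrite /lebesgue_rV /pushforward preimage_bigcup.
apply: measure_semi_sigma_additive.
- by move=> n; exact: mpre.
- apply/trivIsetP => /= i j _ _ ij; rewrite -preimage_setI.
  by move/trivIsetP : tF => /(_ _ _ _ _ ij) ->//; rewrite preimage_set0.
- by rewrite -preimage_bigcup; exact: mpre.
Qed.

HB.instance Definition _ := isMeasure.Build _ _ _ lebesgue_rV
  leb0 leb_ge0 leb_sigma_additive.

End lebesgue_rV.

Lemma lebesgue_tuple_box (R : realType) (m : nat)
    (A : 'I_m -> set (measurableTypeR R)) :
  (forall i, measurable (A i)) ->
  (lebesgue_tuple R m [set t : m.-tuple (measurableTypeR R) | forall i, A i (tnth t i)] =
   \prod_(i < m) lebesgue_measure (A i))%E.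
Proof.
elim: m A => [|m IHm] A mA /=.
  by rewrite big_ord0 diracE mem_set// => -[].
rewrite big_ord_recl -IHm//.
rewrite -product_measure1E//; last first.
  rewrite [X in measurable X](_ : _ = \bigcap_(i in [set: 'I_m])
    ((@tnth _ _)^~ i @^-1` A (lift ord0 i))); last first.
    by apply/seteqP; split => [t tA i _|t tA i]; exact: tA.
  apply: fin_bigcap_measurable => // i _.
  by rewrite -[X in measurable X]setTI; exact: measurable_tnth.
rewrite /tuple_cons_measure /pushforward; congr ((_ \x _)%E _).
apply/seteqP; split => [[x t] /= tA|[x t] [/= xA tA] i].
  split => [|i]; first by have := tA ord0.
  by have := tA (lift ord0 i); rewrite tnthS.
by case: (unliftP ord0 i) => [j|] ->; rewrite ?tnthS//; exact: tA.
Qed.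

Lemma lebesgue_rV_box (R : realType) (m : nat) (a b : 'rV[R]_m) :
  (forall i, a ord0 i <= b ord0 i) ->
  lebesgue_rV [set x : borel_rV R m |
      forall i, (x : 'rV[R]_m) ord0 i \in `]a ord0 i, b ord0 i[] =
  (\prod_(i < m) (b ord0 i - a ord0 i))%:E.
Proof.
move=> ab; rewrite /lebesgue_rV /pushforward.
pose A i : set (measurableTypeR R) := `]a ord0 i, b ord0 i[%classic.
have -> : \prod_(i < m) (b ord0 i - a ord0 i) =
    fine (\prod_(i < m) lebesgue_measure (A i))%E.
  rewrite (eq_bigr (fun i => (b ord0 i - a ord0 i)%:E)); first by rewrite prodEFin.
  move=> i _; rewrite /A lebesgue_measure_itv/= lte_fin.
  by case: ltgtP (ab i) => // ->; rewrite subrr.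
rewrite fineK; last first.
  by rewrite prode_fin_num// => i _; rewrite /A lebesgue_measure_itv/=; case: ifP.
rewrite -lebesgue_tuple_box; last by move=> i; exact: measurable_itv.
congr (lebesgue_tuple R m _); apply/seteqP.
by split => t /= h i; have := h i; rewrite mxE.
Qed.

Record boundedDomain (R : realType) (m : nat) := BoundedDomain {
  domain_set :> set 'rV[R]_m;
  domain_nonempty : domain_set !=set0;
  domain_open : open domain_set;
  domain_connected : connected domain_set;
  domain_bounded : bounded_set domain_set }.

Section L2.
Context (R : realType) (m : nat) (Omega : boundedDomain R m).

Lemma domain_measurable : measurable (Omega : set (borel_rV R m)).
Proof. apply: sub_sigma_algebra; exact: domain_open. Qed.

Definition domain_measure : {measure set (borel_rV R m) -> \bar R} :=
  mrestr (@lebesgue_rV R m) domain_measurable.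

(* domain_measure vanishes outside Omega, so only the restriction to Omega of an
   element of L2 matters. Elements are representatives rather than classes: those
   that agree a.e. on Omega have the same inner products and norms, and they are at
   distance 0, so continuity into L2 is also that of the induced classes. *)
Definition L2 : lmodType R := LfunType domain_measure (lee1n 2).

Definition L2inner (f g : L2) : R :=
  \int[domain_measure]_x ((f : LfunType domain_measure (lee1n 2)) x *
                          (g : LfunType domain_measure (lee1n 2)) x).

Definition L2norm (f : L2) : R :=
  fine 'N[domain_measure]_2
    [EFin \o (f : LfunType domain_measure (lee1n 2))].

Definition L2_continuous_on (A : set R) (u : R -> L2) : Prop :=
  forall t, A t -> (fun s => L2norm (u s - u t)) @ within A (nbhs t) --> (0 : R).

End L2.

Definition Gamma (R : realType) (z : R) : R :=
  \int[lebesgue_measure]_(t in `]0%R, +oo[) (t `^ (z - 1) * expR (- t)).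

Section Lalpha_operator.
Context (R : realType) (al : R).

Definition coef_a (j : nat) : R :=
  - (3 / 2) * (2 - al) * j.+1%:R `^ (1 - al)
  + 1 / 2 * (2 - al) * j%:R `^ (1 - al)
  + j.+1%:R `^ (2 - al) - j%:R `^ (2 - al).

Definition coef_b (j : nat) : R :=
  2 * (2 - al) * j.+1%:R `^ (1 - al)
  - 2 * j.+1%:R `^ (2 - al) + 2 * j%:R `^ (2 - al).

Definition coef_c (j : nat) : R :=
  - (1 / 2) * (2 - al) * (j.+1%:R `^ (1 - al) + j%:R `^ (1 - al))
  + j.+1%:R `^ (2 - al) - j%:R `^ (2 - al).

(* The indices start at 1; the value of coef_d at 0 is irrelevant. *)
Definition coef_d (j : nat) : R :=
  if j == 1%N then coef_c 1 + 2 - 2 * al else coef_c j - coef_a j.-1.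

Context (V : lmodType R) (dt : R).
Implicit Type u : nat -> V.

(* Index subtraction is on nat; it is never truncated for k >= 1, the only range
   in which diffq and Lalpha are meaningful. *)
Definition diffq u (k : nat) : V := dt^-1 *: (u k - u (k - 1)%N).

Definition Lalpha u (k : nat) : V :=
  if k == 1%N then (Gamma (2 - al) * dt `^ al)^-1 *: (u 1%N - u 0%N)
  else (Gamma (3 - al) * dt `^ al)^-1 *:
    (\sum_(1 <= j < k)
        (coef_a j *: u (k - j - 1)%N + coef_b j *: u (k - j)%N
         + coef_c j *: u (k - j + 1)%N)
     + (al / 2) *: u (k - 2)%N - 2 *: u (k - 1)%N + ((4 - al) / 2) *: u k).

End Lalpha_operator.

(* Main.v *)
Require Import Defs.
From mathcomp Require Import all_boot all_order all_algebra.
From mathcomp Require Import all_classical all_reals all_analysis.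
From mathcomp Require Import measurable_realfun.
From mathcomp Require Import ssrAC lra ring zify.
Set Implicit Arguments.
Unset Strict Implicit.
Unset Printing Implicit Defensive.
Import Order.TTheory GRing.Theory Num.Theory.
Import numFieldNormedType.Exports.
Local Open Scope classical_set_scope.
Local Open Scope ring_scope.

(** Put kappa = dt^(1 - al) / Gamma (3 - al), let D_k be the difference
quotients and g_k = d_k - c_k.  Up to the factor kappa, L_1 = S_1 + al D_1 and,
for k >= 2,
    L_k = (3 al / 2) D_k - (al / 2) D_(k-1) + S_k,
    S_k = g_k D_1 + sum of d_(k-j+1) D_j over 2 <= j <= k
([Lalpha_first], which needs Gamma (z + 1) = z Gamma z, and [Lalpha_later]).
The history part S and the two local terms are estimated separately.

The history part contributes a nonnegative amount.  Let K be the triangular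
matrix with S = K D.  The weights d_(n-k+1) are the n-th row of K, except for an
excess c_n >= 0 at k = 1, where it multiplies <S_1, D_1> = g_1 |D_1|^2 >= 0.
With the n-th row itself as weights, the sum of K_nk <S_k, D_k> is at least
|S_n|^2 / 2 ([kernel_energy_ge]): since the ratios of consecutive rows of K are
monotone, the part of row n left of the diagonal is a nonnegative combination of
the earlier rows, and since the first column decreases its coefficients add up
to at most 1, so that a strong induction applies.

In the local part, <D_(k-1), D_k> / 2 <= |D_k|^2 / 2 + |D_(k-1)|^2 / 8.  As
d_j <= (14/3) d_(j+1), moving the last term from the weight of k to that of
k - 1 costs at most 7/12.  What remains is 3/2 - 1/2 - 7/12 = 5/12 for k >= 2,
and 1 - 7/12 = 5/12 for k = 1.

It remains to see that d is positive and log-convex with d_j <= (14/3) d_(j+1),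
that g is positive and decreasing with d_k g_k <= d_(k-1) g_(k+1), and that
c >= 0.  Let q (x) = x^(2 - al).  For k >= 2, d_k is the second difference at k
of F = q - q' / 2, whose second derivative is a positive combination of
x^(-al) and x^(-al-1); g_k is the integral of q'' over [k-1, k] against a
positive weight; and c_k is the error of the trapezoidal rule for the concave
function q'.  Inequalities between neighbouring coefficients thus reduce to
inequalities between powers.  The coefficients d_1 and g_1 do not follow this
pattern and are compared with their neighbours explicitly, with
A = (1/2)^al and G = (2/3)^al enclosed between polynomials in al. *)

(** * Forms that are linear on the left *)

Section linear_in_left.
Context (R : realFieldType) (V : lmodType R) (ip : V -> V -> R).
Context (ip_lin : forall a u v w, ip (a *: u + v) w = a * ip u w + ip v w).

Lemma form_addl u v w : ip (u + v) w = ip u w + ip v w.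
Proof. by rewrite -[u in LHS]scale1r ip_lin mul1r. Qed.

Lemma form_0l w : ip 0 w = 0.
Proof.
have := form_addl 0 0 w; rewrite addr0 => /esym/eqP.
by rewrite -subr_eq0 addrK => /eqP.
Qed.

Lemma form_scalel a u w : ip (a *: u) w = a * ip u w.
Proof. by rewrite -[a *: u]addr0 ip_lin form_0l addr0. Qed.

Lemma form_oppl u w : ip (- u) w = - ip u w.
Proof. by rewrite -scaleN1r form_scalel mulN1r. Qed.

Lemma form_suml (n : nat) (a : nat -> R) (D : nat -> V) w :
  ip (\sum_(k < n) a k *: D k) w = \sum_(k < n) a k * ip (D k) w.
Proof.
elim: n => [|n IHn]; first by rewrite !big_ord0 form_0l.
by rewrite !big_ord_recr/= form_addl form_scalel IHn.
Qed.

End linear_in_left.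

(** * Triangular kernels with monotone row ratios *)

Lemma antitone_upto (R : realFieldType) (m : nat) (f : nat -> R) :
  (forall j, (j.+1 < m.+1)%N -> f j.+1 <= f j) ->
  forall i j, (i <= j <= m)%N -> f j <= f i.
Proof.
move=> fS i; elim=> [|j IHj]; first by rewrite leqn0 => /andP[/eqP->].
move=> /andP[]; rewrite leq_eqVlt ltnS => /predU1P[->//|ij jm].
by apply: le_trans (IHj _); [exact: fS|rewrite ij ltnW].
Qed.

Section triangular_kernel.
Context (R : realFieldType) (K : nat -> nat -> R).
Context (K_gt0 : forall i j, (j <= i)%N -> 0 < K i j).
Context (K_ratio : forall i j, (j < i)%N ->
  K i.+1 j.+1 * K i j <= K i.+1 j * K i j.+1).

(** Subtract from the vector the multiple of row m that cancels its last entry.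
Relative to row m the remainder is rho minus its minimum, so it is nonnegative;
relative to row m - 1 it is that difference times the ratio of the rows m and
m - 1, a product of two nonnegative nonincreasing functions.  Hence the
construction can be repeated with row m - 1.  The vector is given by its
ratios rho to the last row, in which form this induction is closed. *)
Lemma row_cone (m : nat) (rho : nat -> R) :
  (forall j, (j < m)%N -> 0 <= rho j) ->
  (forall j, (j.+1 < m)%N -> rho j.+1 <= rho j) ->
  exists2 y : nat -> R, (forall i, (i < m)%N -> 0 <= y i) &
    forall j, (j < m)%N -> K m.-1 j * rho j = \sum_(j <= i < m) y i * K i j.
Proof.
elim: m rho => [|m IHm] rho rho_ge0 rho_ni; first by exists (fun=> 0).
have rho_min j : (j <= m)%N -> rho m <= rho j.
  by move=> jm; apply: (@antitone_upto _ m) => //; rewrite jm /=.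
have Km_gt0 j : (j <= m)%N -> 0 < K m j by exact: K_gt0.
have [||y y_ge0 yE] := IHm (fun j => K m j / K m.-1 j * (rho j - rho m)).
- move=> j jm; rewrite mulr_ge0 ?subr_ge0 ?rho_min 1?ltnW//.
  by rewrite divr_ge0// ltW// K_gt0//; lia.
- case: m => [//|m] in rho rho_ge0 rho_ni rho_min Km_gt0 IHm *.
  move=> j; rewrite ltnS /= => jm.
  have K1 : 0 < K m j by rewrite K_gt0// ltnW.
  have K2 : 0 < K m j.+1 by rewrite K_gt0.
  apply: ler_pM.
  + by rewrite divr_ge0// ltW// Km_gt0//; lia.
  + by rewrite subr_ge0 rho_min//; lia.
  + by rewrite ler_pdivrMr// mulrAC ler_pdivlMr// K_ratio.
  + by rewrite lerD2r rho_ni//; lia.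
exists (fun i => if i == m then rho m else y i) => [i|j].
  by rewrite ltnS leq_eqVlt; case: eqVneq => [_ _|_ /= /y_ge0//]; exact: rho_ge0.
rewrite ltnS => jm; rewrite big_nat_recr//= eqxx.
move: jm; rewrite leq_eqVlt => /predU1P[->|jm].
  by rewrite big_geq// add0r mulrC.
transitivity (\sum_(j <= i < m) y i * K i j + rho m * K m j); last first.
  by congr (_ + _); apply: eq_big_nat => i /andP[_ im]; rewrite ltn_eqF.
rewrite -yE//.
have K1 : K m.-1 j != 0 by rewrite gt_eqF// K_gt0//; lia.
by field.
Qed.

Context (K_col0 : forall i, K i.+1 0%N <= K i 0%N).

Context (V : lmodType R) (ip : V -> V -> R).
Context (ipC : forall u v, ip u v = ip v u).
Context (ip_lin : forall a u v w, ip (a *: u + v) w = a * ip u w + ip v w).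
Context (ip_ge0 : forall u, 0 <= ip u u).

Let S n (D : nat -> V) := \sum_(k < n.+1) K n k *: D k.

Let ipDl := form_addl ip_lin.
Let ipNl := form_oppl ip_lin.

Let ip_sumr (n : nat) (a : nat -> R) (D : nat -> V) u :
  ip u (\sum_(k < n) a k *: D k) = \sum_(k < n) a k * ip u (D k).
Proof.
rewrite ipC (form_suml ip_lin); apply: eq_bigr => k _; by rewrite ipC.
Qed.

(** The left side is half of the sum of K_nk <S_n, D_k>, so the claim bounds the
sum of K_nk <S_n - S_k, D_k> over k < n by |S_n|^2 / 2.  By [row_cone] that sum
is a combination, with coefficients y_i, of the same sums for the rows i < n
with S_n kept in place; by induction each of them is at most
<S_n, S_i> - |S_i|^2 / 2 <= |S_n|^2 / 2, and the y_i add up to at most 1. *)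
Lemma kernel_energy_ge (D : nat -> V) (n : nat) :
  ip (S n D) (S n D) / 2 <= \sum_(k < n.+1) K n k * ip (S k D) (D k).
Proof.
have [m] := ubnP n; elim: m => // m IHm in n *; rewrite ltnS => nm.
have [||y y_ge0 yE] := @row_cone n (fun j => K n j / K n.-1 j).
- by move=> j jn; rewrite divr_ge0// ltW// K_gt0//; lia.
- case: n nm => // n nm j; rewrite ltnS /= => jn.
  have K1 : 0 < K n j by rewrite K_gt0// ltnW.
  have K2 : 0 < K n j.+1 by rewrite K_gt0.
  by rewrite ler_pdivrMr// mulrAC ler_pdivlMr// K_ratio.
have {}yE j : (j < n)%N -> K n j = \sum_(j <= i < n) y i * K i j.
  move=> jn; rewrite -yE// mulrC divfK// gt_eqF// K_gt0//; lia.
(* The first column decreases: compare the entries at 0 of both sides. *)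
have y_le1 : \sum_(0 <= i < n) y i <= 1.
  case: n nm y_ge0 yE => [|n] nm y_ge0 yE; first by rewrite big_geq.
  have K0 : 0 < K n.+1 0%N by exact: K_gt0.
  rewrite -(ler_pM2r K0) mul1r [leRHS]yE// mulr_suml.
  rewrite big_nat_cond [leRHS]big_nat_cond; apply: ler_sum => i /andP[ilt _].
  rewrite ler_wpM2l ?y_ge0//.
  apply: (@antitone_upto _ n.+1 (fun i => K i 0%N)) => [j _|]; first exact: K_col0.
  by lia.
have Ssplit : ip (S n D) (S n D) = \sum_(k < n.+1) K n k * ip (S n D) (D k).
  by rewrite {2}/S ip_sumr.
suff : \sum_(k < n) K n k * (ip (S n D) (D k) - ip (S k D) (D k)) <=
    ip (S n D) (S n D) / 2.
  rewrite [X in _ -> _ <= X]big_ord_recr/= => h.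
  have : \sum_(k < n) K n k * (ip (S n D) (D k) - ip (S k D) (D k)) =
     ip (S n D) (S n D) - \sum_(k < n) K n k * ip (S k D) (D k)
     - K n n * ip (S n D) (D n).
    rewrite [X in _ = X - _ - _]Ssplit big_ord_recr/= addrAC addrK -sumrB.
    by apply: eq_bigr => k _; rewrite mulrBr.
  lra.
set Z := S n D.
have -> : \sum_(k < n) K n k * (ip Z (D k) - ip (S k D) (D k)) =
    \sum_(i < n) y i * \sum_(k < i.+1) K i k * (ip Z (D k) - ip (S k D) (D k)).
  under eq_bigr => k _ do rewrite yE// mulr_suml.
  rewrite -(big_mkord xpredT (fun k => \sum_(k <= i < n)
    y i * K i k * (ip Z (D k) - ip (S k D) (D k)))).
  under eq_bigr => k _ do rewrite (big_nat_widenl _ 0%N)//=.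
  rewrite (exchange_big_dep_nat xpredT)//= big_mkord; apply: eq_bigr => i _.
  rewrite mulr_sumr -(big_mkord xpredT (fun k => y i *
    (K i k * (ip Z (D k) - ip (S k D) (D k))))).
  rewrite [RHS](big_nat_widen _ _ n)//=.
  by apply: eq_big => [k|k _]; rewrite ?mulrA.
apply: (@le_trans _ _ (\sum_(i < n) y i * (ip Z Z / 2))).
  apply: ler_sum => i _; rewrite ler_wpM2l ?y_ge0//.
  have -> : \sum_(k < i.+1) K i k * (ip Z (D k) - ip (S k D) (D k)) =
      ip Z (S i D) - \sum_(k < i.+1) K i k * ip (S k D) (D k).
    rewrite {2}/S ip_sumr -sumrB; apply: eq_bigr => k _; exact: mulrBr.
  have := IHm i (leq_trans (ltn_ord i) nm).
  have := ip_ge0 (Z - S i D); rewrite ipDl ipNl ![ip _ (_ - _)]ipC !ipDl !ipNl.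
  rewrite (ipC (S i D) Z); lra.
rewrite -mulr_suml -[leRHS]mul1r ler_wpM2r ?divr_ge0 ?ip_ge0//.
by rewrite -(big_mkord xpredT y).
Qed.

End triangular_kernel.

(** * The energy inequality for abstract coefficients *)

Section weighted_energy.
Context (R : realFieldType).

(** The margin 7/12 (w p * x p) on the left makes the induction work: it pays
for the x p / 8 of the next step, since 14/3 * 1/8 = 7/12. *)
Lemma quadratic_tail (w x z : nat -> R) :
  (forall k, 0 <= w k) -> (forall k, 0 <= x k) ->
  (forall k, z k.+1 <= x k.+1 / 2 + x k / 8) ->
  forall p, (forall k, (k < p)%N -> w k.+1 <= 14 / 3 * w k) ->
  5 / 12 * \sum_(k < p.+1) w k * x k + 7 / 12 * (w p * x p) <=
  w 0%N * x 0%N + \sum_(k < p) w k.+1 * (3 / 2 * x k.+1 - z k.+1).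
Proof.
move=> w_ge0 x_ge0 xz; elim=> [|p IHp] w_le.
  by rewrite big_ord_recr !big_ord0 /=; lra.
rewrite big_ord_recr [X in _ <= _ + X]big_ord_recr/=.
have /IHp : forall k, (k < p)%N -> w k.+1 <= 14 / 3 * w k.
  by move=> k kp; rewrite w_le// ltnW.
have : w p.+1 * x p <= 14 / 3 * w p * x p by rewrite ler_wpM2r// w_le.
have : w p.+1 * z p.+1 <= w p.+1 * (x p.+1 / 2 + x p / 8) by rewrite ler_wpM2l.
set s := \sum_(k < p.+1) _; set t := \sum_(k < p) _.
nra.
Qed.

(** Column 0 belongs to the first difference quotient, whose coefficient g
differs from the Toeplitz coefficient d. *)
Definition history_kernel (d g : nat -> R) (i j : nat) : R :=
  if j is 0 then g i else d (i - j)%N.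

Context (V : lmodType R) (ip : V -> V -> R).
Context (ipC : forall u v, ip u v = ip v u).
Context (ip_lin : forall a u v w, ip (a *: u + v) w = a * ip u w + ip v w).
Context (ip_ge0 : forall u, 0 <= ip u u).

Context (d g : nat -> R).
Context (d_gt0 : forall i, 0 < d i) (g_gt0 : forall i, 0 < g i).
Context (g_le_d : forall i, g i <= d i).
Context (g_ni : forall i, g i.+1 <= g i).
Context (d_logconvex : forall i, d i.+1 ^+ 2 <= d i * d i.+2).
Context (dg_ratio : forall i, d i.+1 * g i.+1 <= d i * g i.+2).
Context (d_le : forall i, d i <= 14 / 3 * d i.+1).

(** Indices are shifted by one: v k and d k stand for the difference quotient
and the coefficient of index k + 1. *)
Lemma weighted_energy (al : R) (v M : nat -> V) (p : nat) : 0 <= al ->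
  M 0%N = g 0%N *: v 0%N + al *: v 0%N ->
  (forall k, (k < p)%N -> M k.+1 =
     (3 / 2 * al) *: v k.+1 - (al / 2) *: v k +
     \sum_(j < k.+2) history_kernel d g k.+1 j *: v j) ->
  5 / 12 * al * (\sum_(k < p.+1) d (p - k)%N * ip (v k) (v k)) <=
  \sum_(k < p.+1) d (p - k)%N * ip (M k) (v k).
Proof.
move=> al_ge0 M0 MS.
pose K := history_kernel d g.
pose S k := \sum_(j < k.+1) K k j *: v j.
have ipDl := form_addl ip_lin; have ipZl := form_scalel ip_lin.
have ipNl := form_oppl ip_lin.
have K_gt0 i j : (j <= i)%N -> 0 < K i j by case: j => [|j] _; rewrite /K/=.
have K_ratio i j : (j < i)%N -> K i.+1 j.+1 * K i j <= K i.+1 j * K i j.+1.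
  case: j => [|j] ji; rewrite /K/=.
    by case: i ji => // i _; rewrite subSS subn0 subSS subn0 [leRHS]mulrC.
  rewrite !subSS; have -> : (i - j = (i - j.+2).+2)%N by lia.
  have -> : (i - j.+1 = (i - j.+2).+1)%N by lia.
  by rewrite -expr2 [leRHS]mulrC.
have K_col0 i : K i.+1 0%N <= K i 0%N by exact: g_ni.
have := kernel_energy_ge K_gt0 K_ratio K_col0 ipC ip_lin ip_ge0 v p.
have S_ge0 := ip_ge0 (S p).
pose w k := d (p - k)%N.
move=> /(le_trans (divr_ge0 S_ge0 (ler0n _ 2))).
(* The weights d (p - k) are the last row of K, up to an excess in column 0. *)
have -> : \sum_(k < p.+1) K p k * ip (S k) (v k) =
    \sum_(k < p.+1) w k * ip (S k) (v k) - (d p - g p) * (g 0%N * ip (v 0%N) (v 0%N)).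
  rewrite !big_ord_recl /= /w subn0 /S big_ord_recl big_ord0 addr0 ipZl /K/=.
  ring.
move=> hS.
have c_ge0 : 0 <= (d p - g p) * (g 0%N * ip (v 0%N) (v 0%N)).
  by rewrite !mulr_ge0 ?subr_ge0 ?(ltW (g_gt0 _)).
have {hS c_ge0} hS : 0 <= \sum_(k < p.+1) w k * ip (S k) (v k) by lra.
have ME : \sum_(k < p.+1) w k * ip (M k) (v k) =
  \sum_(k < p.+1) w k * ip (S k) (v k) +
  al * (w 0%N * ip (v 0%N) (v 0%N) +
    \sum_(k < p) w k.+1 * (3 / 2 * ip (v k.+1) (v k.+1) - ip (v k) (v k.+1) / 2)).
  rewrite !big_ord_recl/= M0 /S big_ord_recl big_ord0 addr0 ipDl !ipZl.
  rewrite [X in _ + X = _](_ : _ = \sum_(k < p) w k.+1 * ip (S k.+1) (v k.+1) +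
    al * \sum_(k < p) w k.+1 * (3 / 2 * ip (v k.+1) (v k.+1) - ip (v k) (v k.+1) / 2)).
    by rewrite /S/K/=; ring.
  rewrite mulr_sumr -big_split/=; apply: eq_bigr => k _.
  by rewrite /bump /= add1n MS// !ipDl ipNl !ipZl; ring.
rewrite [leRHS]ME.
suff : 5 / 12 * \sum_(k < p.+1) w k * ip (v k) (v k) <=
    w 0%N * ip (v 0%N) (v 0%N) + \sum_(k < p)
      w k.+1 * (3 / 2 * ip (v k.+1) (v k.+1) - ip (v k) (v k.+1) / 2).
  move=> /(ler_wpM2l al_ge0); rewrite -/w; lra.
apply: le_trans (quadratic_tail (w := w) (x := fun k => ip (v k) (v k))
  (z := fun k => ip (v k.-1) (v k) / 2) _ _ _ (p := p) _).
- rewrite lerDl; apply: mulr_ge0; first by lra.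
  by apply: mulr_ge0 => //; apply: ltW; rewrite /w.
- by move=> k; apply: ltW; rewrite /w.
- by move=> k; exact: ip_ge0.
(* Young's inequality, with the larger share put on the later term. *)
- move=> k /=; have := ip_ge0 (v k.+1 + (- (1 / 2)) *: v k).
  rewrite !(ipDl, ipZl) ![ip _ (_ + _)]ipC !(ipDl, ipZl) (ipC (v k.+1) (v k)).
  lra.
- move=> k kp; rewrite /w; have -> : (p - k = (p - k.+1).+1)%N by lia.
  by rewrite d_le.
Qed.

End weighted_energy.

(** * Inequalities from the sign of a derivative *)

Section calculus.
Context {R : realType}.
Implicit Types (f g : R -> R) (a b k l x : R).

(** A plain proposition in place of a class: the rules below are applied by hand,
also to derivatives that are still to be found. *)
Definition has_derivative f x l : Prop := is_derive x (1 : R) f l.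

Lemma has_derivative_eq f x a b : has_derivative f x a -> a = b -> has_derivative f x b.
Proof. by move=> ? <-. Qed.

Lemma has_derivative_cst (k x : R) : has_derivative (fun=> k) x 0.
Proof. exact: is_derive_cst. Qed.

Lemma has_derivative_id (x : R) : has_derivative (fun t => t) x 1.
Proof. exact: is_derive_id. Qed.

Lemma has_derivativeD f g x a b : has_derivative f x a -> has_derivative g x b ->
  has_derivative (fun t => f t + g t) x (a + b).
Proof. exact: is_deriveD. Qed.

Lemma has_derivativeB f g x a b : has_derivative f x a -> has_derivative g x b ->
  has_derivative (fun t => f t - g t) x (a - b).
Proof. exact: is_deriveB. Qed.

Lemma has_derivativeZ f x k a : has_derivative f x a ->
  has_derivative (fun t => k * f t) x (k * a).
Proof. exact: is_deriveZ. Qed.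

Lemma has_derivativeM f g x a b : has_derivative f x a -> has_derivative g x b ->
  has_derivative (fun t => f t * g t) x (f x * b + g x * a).
Proof. exact: is_deriveM. Qed.

Lemma has_derivative_comp f g x a b : has_derivative f (g x) a -> has_derivative g x b ->
  has_derivative (fun t => f (g t)) x (a * b).
Proof. exact: is_derive1_comp. Qed.

Lemma has_derivative_addr x k : has_derivative (fun t => t + k) x 1.
Proof.
rewrite -[1]addr0; apply: has_derivativeD; first exact: has_derivative_id.
exact: has_derivative_cst.
Qed.

Lemma has_derivative_subl x k : has_derivative (fun t => k - t) x (-1).
Proof.
rewrite -[-1]sub0r; apply: has_derivativeB; first exact: has_derivative_cst.
exact: has_derivative_id.
Qed.

Lemma has_derivative_shift f x k a : has_derivative f (x + k) a ->
  has_derivative (fun t => f (t + k)) x a.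
Proof.
move=> fa; rewrite -[a]mulr1.
exact: (@has_derivative_comp f (fun t => t + k) x a 1 fa (has_derivative_addr x k)).
Qed.

Lemma has_derivative_reflect f x k a : has_derivative f (k - x) a ->
  has_derivative (fun t => f (k - t)) x (- a).
Proof.
move=> fa; rewrite -mulrN1.
exact: (@has_derivative_comp f (fun t => k - t) x a _ fa (has_derivative_subl x k)).
Qed.

Lemma has_derivative_powR (r r' x : R) : 0 < x -> r' = r - 1 ->
  has_derivative (fun t => t `^ r) x (r * x `^ r').
Proof. by move=> ? ->; exact: is_derive1_powR. Qed.

Lemma le_of_derivative f f' a b : a <= b ->
  (forall x, a <= x <= b -> has_derivative f x (f' x)) ->
  (forall x, a <= x <= b -> 0 <= f' x) -> f a <= f b.
Proof.
move=> ab df f'_ge0.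
have [||c] := @MVT_segment R f f' a b ab.
- by move=> x; rewrite in_itv/= => /andP[ax xb]; apply: df; rewrite !ltW.
- apply: derivable_within_continuous => x; rewrite in_itv/= => xab.
  by have [] := df x xab.
rewrite in_itv/= => cab fE; rewrite -subr_ge0 fE mulr_ge0 ?f'_ge0//.
by rewrite subr_ge0.
Qed.

(** The second difference is the integral of (1 - s) (H'' (m + s) + H'' (m - s))
over 0 <= s <= 1; below, f is a primitive of the integrand. *)
Lemma second_difference_ge0 (H H1 H2 : R -> R) (m : R) :
  (forall x, m - 1 <= x <= m + 1 -> has_derivative H x (H1 x)) ->
  (forall x, m - 1 <= x <= m + 1 -> has_derivative H1 x (H2 x)) ->
  (forall s, 0 <= s <= 1 -> 0 <= H2 (m + s) + H2 (m - s)) ->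
  0 <= H (m - 1) - 2 * H m + H (m + 1).
Proof.
move=> dH dH1 H2_ge0.
pose f s := (1 - s) * (H1 (s + m) - H1 (m - s)) + (H (s + m) + H (m - s)).
have : f 0 <= f 1.
  apply: (le_of_derivative (f' := fun s => (1 - s) * (H2 (m + s) + H2 (m - s)))).
  - exact: ler01.
  - move=> s /andP[s0 s1]; apply: has_derivative_eq.
      apply: has_derivativeD; last apply: has_derivativeD.
        apply: has_derivativeM; first exact: has_derivative_subl.
        apply: has_derivativeB.
      + by apply/has_derivative_shift/dH1; lra.
      + by apply/has_derivative_reflect/dH1; lra.
      + by apply/has_derivative_shift/dH; lra.
      + by apply/has_derivative_reflect/dH; lra.
    by rewrite /= (addrC s m); ring.
  - by move=> s s01; rewrite mulr_ge0 ?H2_ge0//; lra.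
rewrite /f !subr0 !subrr !add0r (addrC 1 m); lra.
Qed.

(** The right side is the integral of (s - m + 1/2) Q'' (s) over m <= s <= m + 1,
and f is a primitive of the integrand. *)
Lemma tilted_mean_ge0 (Q Q1 Q2 : R -> R) (m : R) :
  (forall x, m <= x <= m + 1 -> has_derivative Q x (Q1 x)) ->
  (forall x, m <= x <= m + 1 -> has_derivative Q1 x (Q2 x)) ->
  (forall x, m <= x <= m + 1 -> 0 <= Q2 x) ->
  0 <= 3 / 2 * Q1 (m + 1) - 1 / 2 * Q1 m - Q (m + 1) + Q m.
Proof.
move=> dQ dQ1 Q2_ge0.
pose f s := (s + (1 / 2 - m)) * Q1 s - Q s.
have : f m <= f (m + 1).
  apply: (le_of_derivative (f' := fun s => (s + (1 / 2 - m)) * Q2 s)).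
  - by rewrite lerDl.
  - move=> s sm; apply: has_derivative_eq.
      apply: has_derivativeB (dQ _ sm); apply: has_derivativeM (dQ1 _ sm).
      exact: has_derivative_addr.
    by rewrite /=; ring.
  - by move=> s sm; rewrite mulr_ge0 ?Q2_ge0//; lra.
rewrite /f; lra.
Qed.

(** The difference of the two sides is the integral of
- (s - m) (m + 1 - s) / 2 * Q''' (s) over m <= s <= m + 1. *)
Lemma trapezoid_le (Q Q1 Q2 Q3 : R -> R) (m : R) :
  (forall x, m <= x <= m + 1 -> has_derivative Q x (Q1 x)) ->
  (forall x, m <= x <= m + 1 -> has_derivative Q1 x (Q2 x)) ->
  (forall x, m <= x <= m + 1 -> has_derivative Q2 x (Q3 x)) ->
  (forall x, m <= x <= m + 1 -> Q3 x <= 0) ->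
  (Q1 m + Q1 (m + 1)) / 2 <= Q (m + 1) - Q m.
Proof.
move=> dQ dQ1 dQ2 Q3_le0.
pose f s := 1 / 2 * ((s + - m) * (s + (- m - 1))) * Q2 s -
  (s + (- m - 1 / 2)) * Q1 s + Q s.
have : f m <= f (m + 1).
  apply: (le_of_derivative
    (f' := fun s => 1 / 2 * ((s + - m) * (s + (- m - 1))) * Q3 s)).
  - by rewrite lerDl.
  - move=> s sm; apply: has_derivative_eq.
      apply: has_derivativeD (dQ _ sm); apply: has_derivativeB.
        apply: has_derivativeM (dQ2 _ sm); apply: has_derivativeZ.
        by apply: has_derivativeM; exact: has_derivative_addr.
      by apply: has_derivativeM (dQ1 _ sm); exact: has_derivative_addr.
    by rewrite /=; field.
  - move=> s sm; rewrite mulr_le0 ?Q3_le0//.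
    by rewrite pmulr_rle0// mulr_ge0_le0//; lra.
rewrite /f; lra.
Qed.

End calculus.

(** * Inequalities between powers *)

Section powers.
Context {R : realType}.
Implicit Types (x y r s : R).

Lemma powR_succ x r r' : 0 < x -> r' = r + 1 -> x `^ r' = x * x `^ r.
Proof.
by move=> x0 ->; rewrite addrC powRD ?powRr1 ?ltW// (gt_eqF x0) implybT.
Qed.

(** The quadratic polynomial in lam has a nonpositive discriminant because
(x - 1) (x + 1) <= x^2. *)
Lemma powRN_logconvex x r (lam : R) : 1 < x -> 0 <= r ->
  0 <= lam ^+ 2 * (x - 1) `^ (- r) - 2 * lam * x `^ (- r) + (x + 1) `^ (- r).
Proof.
move=> x1 r0.
have e : (x `^ (- r)) ^+ 2 <= (x - 1) `^ (- r) * (x + 1) `^ (- r).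
  rewrite expr2 -!powRM; try lra.
  rewrite !powRN lef_pV2 ?posrE ?powR_gt0; try nra.
  by apply: ge0_ler_powR => //; rewrite ?nnegrE; nra.
have : 0 < (x - 1) `^ (- r) by apply: powR_gt0; lra.
have : 0 < (x + 1) `^ (- r) by apply: powR_gt0; lra.
move: e; set a := (x - 1) `^ _; set b := x `^ _; set c := (x + 1) `^ _.
move=> e c0 a0.
rewrite -(pmulr_rge0 _ a0).
have -> : a * (lam ^+ 2 * a - 2 * lam * b + c) =
  (lam * a - b) ^+ 2 + (a * c - b ^+ 2) by ring.
by rewrite addr_ge0 ?sqr_ge0// subr_ge0.
Qed.

Lemma sym_powRN_mono r y y' : 0 <= r -> 0 <= y -> y <= y' -> y' < 1 ->
  (1 + y) `^ (- r) + (1 - y) `^ (- r) <= (1 + y') `^ (- r) + (1 - y') `^ (- r).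
Proof.
move=> r0 y0 yy' y1.
pose f t : R := (t + 1) `^ (- r) + (1 - t) `^ (- r).
rewrite (addrC 1 y) (addrC 1 y') -/(f y) -/(f y').
apply: (le_of_derivative (f' := fun t =>
  r * ((1 - t) `^ (- r - 1) - (t + 1) `^ (- r - 1)))) => //.
  move=> t tyy; apply: has_derivative_eq.
    apply: has_derivativeD.
      apply: (has_derivative_shift (f := fun t => t `^ (- r))).
      by apply: has_derivative_powR => //; lra.
    apply: (has_derivative_reflect (f := fun t => t `^ (- r))).
    by apply: has_derivative_powR => //; lra.
  by rewrite /=; ring.
move=> t tyy; rewrite mulr_ge0// subr_ge0 -opprD !powRN.
rewrite lef_pV2 ?posrE ?powR_gt0; try lra.
by apply: ge0_ler_powR; rewrite ?nnegrE; lra.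
Qed.

(** By homogeneity only s / x matters, and it decreases in x. *)
Lemma scaled_sym_powRN_anti r x x' s : 0 <= r -> 0 <= s -> s < x -> x <= x' ->
  x' `^ r * ((x' + s) `^ (- r) + (x' - s) `^ (- r)) <=
  x `^ r * ((x + s) `^ (- r) + (x - s) `^ (- r)).
Proof.
move=> r0 s0 sx xx'.
have scale z : s < z -> z `^ r * ((z + s) `^ (- r) + (z - s) `^ (- r)) =
    (1 + s / z) `^ (- r) + (1 - s / z) `^ (- r).
  move=> sz; have z0 : 0 < z by lra.
  have -> : z + s = z * (1 + s / z) by field; lra.
  have -> : z - s = z * (1 - s / z) by field; lra.
  have sz1 : s / z < 1 by rewrite ltr_pdivrMr// mul1r.
  have sz0 : 0 <= s / z by rewrite divr_ge0// ltW.
  rewrite !powRM; try lra.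
  by rewrite -mulrDr mulrA powRN divff ?mul1r// gt_eqF// powR_gt0.
rewrite !scale//; last by lra.
apply: sym_powRN_mono => //.
- by rewrite divr_ge0//; lra.
- by rewrite ler_wpM2l// lef_pV2// posrE; lra.
- by rewrite ltr_pdivrMr ?mul1r//; lra.
Qed.

End powers.

(** * Neighbouring coefficients for large indices *)

Section coefficients.
Context {R : realType} (al : R).
Context (al_gt0 : 0 < al) (al_lt1 : al < 1).

Let q x : R := x `^ (2 - al).
Let q1 x : R := (2 - al) * x `^ (1 - al).
Let q2 x : R := (2 - al) * ((1 - al) * x `^ (- al)).
Let q3 x : R := (2 - al) * ((1 - al) * (- al * x `^ (- (al + 1)))).

Let dq x : 0 < x -> has_derivative q x (q1 x).
Proof. by move=> x0; apply: has_derivative_powR => //; ring. Qed.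
Let dq1 x : 0 < x -> has_derivative q1 x (q2 x).
Proof. by move=> x0; apply/has_derivativeZ/has_derivative_powR => //; ring. Qed.
Let dq2 x : 0 < x -> has_derivative q2 x (q3 x).
Proof.
by move=> x0; do 2 apply: has_derivativeZ; apply: has_derivative_powR => //; ring.
Qed.

Let F x := q x - 1 / 2 * q1 x.
Let F1 x := q1 x - 1 / 2 * q2 x.
Let F2 x := q2 x - 1 / 2 * q3 x.

Let dF x : 0 < x -> has_derivative F x (F1 x).
Proof. by move=> x0; apply: has_derivativeB (dq x0) _; apply/has_derivativeZ/dq1. Qed.
Let dF1 x : 0 < x -> has_derivative F1 x (F2 x).
Proof. by move=> x0; apply: has_derivativeB (dq1 x0) _; apply/has_derivativeZ/dq2. Qed.

Lemma coef_dE k : coef_d al k.+2 = F k.+1%:R - 2 * F k.+2%:R + F k.+3%:R.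
Proof. by rewrite /coef_d /coef_c /coef_a /F /q /q1 /=; field. Qed.

Lemma coef_aE k : - coef_a al k.+1 =
  3 / 2 * q1 (k.+1%:R + 1) - 1 / 2 * q1 k.+1%:R - q (k.+1%:R + 1) + q k.+1%:R.
Proof. by rewrite natr1 /coef_a /q /q1; field. Qed.

Lemma coef_c_ge0 k : 0 <= coef_c al k.+1.
Proof.
have al0 := al_gt0; have al1 := al_lt1.
have k0 : 0 < k.+1%:R :> R by [].
suff : (q1 k.+1%:R + q1 (k.+1%:R + 1)) / 2 <= q (k.+1%:R + 1) - q k.+1%:R.
  by rewrite natr1 /coef_c /q /q1; lra.
have pos x : k.+1%:R <= x <= k.+1%:R + 1 -> 0 < x.
  by move=> /andP[+ _]; exact: lt_le_trans.
apply: (trapezoid_le (Q2 := q2) (Q3 := q3)).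
- by move=> x /pos; exact: dq.
- by move=> x /pos; exact: dq1.
- by move=> x /pos; exact: dq2.
- move=> x _; rewrite /q3 !mulNr !mulrN oppr_le0 !mulr_ge0 ?powR_ge0//; lra.
Qed.

(** A division-free form of log-convexity.  The left side is the second
difference of lam^2 F (x - 1) - 2 lam F (x) + F (x + 1) at k + 3, and the second
derivative of this function is nonnegative by [powRN_logconvex]. *)
Lemma coef_d_quadratic_ge0 k (lam : R) :
  0 <= lam ^+ 2 * coef_d al k.+2 - 2 * lam * coef_d al k.+3 + coef_d al k.+4.
Proof.
have al0 := al_gt0; have al1 := al_lt1.
have k0 : 0 <= k%:R :> R by [].
pose H x := lam ^+ 2 * F (x + -1) - 2 * lam * F x + F (x + 1).
pose H1 x := lam ^+ 2 * F1 (x + -1) - 2 * lam * F1 x + F1 (x + 1).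
pose H2 x := lam ^+ 2 * F2 (x + -1) - 2 * lam * F2 x + F2 (x + 1).
have H2_ge0 x : 1 < x -> 0 <= H2 x.
  move=> x1.
  have := powRN_logconvex lam x1 (ltW al_gt0).
  have al1_ge0 : 0 <= al + 1 by lra.
  have := powRN_logconvex lam x1 al1_ge0.
  rewrite /H2 /F2 /q2 /q3.
  set b := lam ^+ 2 * _ - _ + _; set a := lam ^+ 2 * _ - _ + _ => b0 a0.
  have -> : lam ^+ 2 * ((2 - al) * ((1 - al) * (x - 1) `^ (- al)) -
      1 / 2 * ((2 - al) * ((1 - al) * (- al * (x - 1) `^ (- (al + 1)))))) -
      2 * lam * ((2 - al) * ((1 - al) * x `^ (- al)) -
      1 / 2 * ((2 - al) * ((1 - al) * (- al * x `^ (- (al + 1)))))) +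
     ((2 - al) * ((1 - al) * (x + 1) `^ (- al)) -
      1 / 2 * ((2 - al) * ((1 - al) * (- al * (x + 1) `^ (- (al + 1)))))) =
    (2 - al) * (1 - al) * (a + al / 2 * b) by rewrite /a /b; field.
  apply: mulr_ge0; first by apply: mulr_ge0; lra.
  by apply: addr_ge0 => //; apply: mulr_ge0 => //; lra.
rewrite !coef_dE -(@natr1 R k.+4) -(@natr1 R k.+3) -(@natr1 R k.+2).
rewrite -(@natr1 R k.+1) -(@natr1 R k).
set m : R := k%:R in k0 *.
have : 0 <= H (m + 1 + 1 + 1 - 1) - 2 * H (m + 1 + 1 + 1) + H (m + 1 + 1 + 1 + 1).
  apply: (second_difference_ge0 (H1 := H1) (H2 := H2)).
  - move=> x xm; apply: has_derivativeD; last by apply/has_derivative_shift/dF; lra.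
    apply: has_derivativeB; apply: has_derivativeZ; last by apply: dF; lra.
    by apply/has_derivative_shift/dF; lra.
  - move=> x xm; apply: has_derivativeD; last by apply/has_derivative_shift/dF1; lra.
    apply: has_derivativeB; apply: has_derivativeZ; last by apply: dF1; lra.
    by apply/has_derivative_shift/dF1; lra.
  - by move=> s s01; rewrite addr_ge0// H2_ge0//; lra.
rewrite /H => h; apply: (le_trans h); rewrite le_eqVlt; apply/orP; left; apply/eqP.
rewrite !(addrNK, addrK); ring.
Qed.

(** Pairing m + s with m - s in [second_difference_ge0] is essential: the
second derivatives cannot be compared at m + s alone. *)
Lemma coef_d_scaled_le k :
  k.+3%:R `^ al * coef_d al k.+3 <= k.+2%:R `^ al * coef_d al k.+2.
Proof.
have al0 := al_gt0; have al1 := al_lt1.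
have k0 : 0 <= k%:R :> R by [].
rewrite !coef_dE -(@natr1 R k.+3) -(@natr1 R k.+2) -(@natr1 R k.+1) -(@natr1 R k).
set m : R := k%:R in k0 *.
set v := (m + 1 + 1 + 1) `^ al; set u := (m + 1 + 1) `^ al.
pose H x := u * F (x + -1) - v * F x.
pose H1 x := u * F1 (x + -1) - v * F1 x.
pose H2 x := u * F2 (x + -1) - v * F2 x.
have : 0 <= H (m + 1 + 1 + 1 - 1) - 2 * H (m + 1 + 1 + 1) + H (m + 1 + 1 + 1 + 1).
  apply: (second_difference_ge0 (H1 := H1) (H2 := H2)).
  - move=> x xm; apply: has_derivativeB; apply: has_derivativeZ; last by apply: dF; lra.
    by apply/has_derivative_shift/dF; lra.
  - move=> x xm; apply: has_derivativeB; apply: has_derivativeZ; last by apply: dF1; lra.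
    by apply/has_derivative_shift/dF1; lra.
  - move=> s /andP[s0 s1].
    have al_ge0 := ltW al0.
    have al1_ge0 : 0 <= al + 1 by lra.
    have sm : s < m + 1 + 1 by lra.
    have mm : m + 1 + 1 <= m + 1 + 1 + 1 by lra.
    have hX := scaled_sym_powRN_anti al_ge0 s0 sm mm.
    have := scaled_sym_powRN_anti al1_ge0 s0 sm mm.
    rewrite (@powR_succ _ (m + 1 + 1) al (al + 1))//; last by lra.
    rewrite (@powR_succ _ (m + 1 + 1 + 1) al (al + 1))//; last by lra.
    rewrite -/u -/v in hX *.
    have e1 : m + 1 + 1 + 1 + s + -1 = m + 1 + 1 + s by ring.
    have e2 : m + 1 + 1 + 1 - s + -1 = m + 1 + 1 - s by ring.
    rewrite /H2 /F2 /q2 /q3 e1 e2; move: hX.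
    have : 0 <= (m + 1 + 1 + s) `^ (- (al + 1)) + (m + 1 + 1 - s) `^ (- (al + 1)).
      by rewrite addr_ge0 ?powR_ge0.
    have : 0 <= u by exact: powR_ge0.
    set Y' := (m + 1 + 1 + s) `^ (- (al + 1)) + _.
    set Y := (m + 1 + 1 + 1 + s) `^ (- (al + 1)) + _.
    set X' := (m + 1 + 1 + s) `^ (- al) + _.
    set X := (m + 1 + 1 + 1 + s) `^ (- al) + _.
    move=> u0 Y0 hX hY.
    (* The exponent al + 1 leaves a spare factor (m + 2) / (m + 3) <= 1. *)
    have {}hY : v * Y <= u * Y'.
      have m0 : 0 < m + 1 + 1 + 1 by lra.
      rewrite -(ler_pM2l m0) mulrA (le_trans hY)// -mulrA ler_wpM2r//.
      by rewrite mulr_ge0.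
    rewrite [leRHS](_ : _ = (2 - al) * (1 - al) *
      ((u * X' - v * X) + al / 2 * (u * Y' - v * Y))); last first.
      by rewrite /X' /X /Y' /Y; field.
    apply: mulr_ge0; first by apply: mulr_ge0; lra.
    apply: addr_ge0; first by rewrite subr_ge0.
    by apply: mulr_ge0; rewrite ?subr_ge0// ; lra.
rewrite /H !(addrNK, addrK) => h; rewrite -subr_ge0; apply: (le_trans h).
rewrite le_eqVlt; apply/orP; left; apply/eqP; ring.
Qed.

(** This bounds g_(k+3) / g_(k+2) from below by ((k + 1) / (k + 2))^al, the power
that bounds d_(k+2) / d_(k+1) from above for k >= 1 by [coef_d_scaled_le]; it
separates the ratios of the first two columns. *)
Lemma coef_a_scaled_le k :
  k.+1%:R `^ al * - coef_a al k.+1 <= k.+2%:R `^ al * - coef_a al k.+2.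
Proof.
have al0 := al_gt0; have al1 := al_lt1.
have k0 : 0 < k.+1%:R :> R by [].
rewrite !coef_aE -(@natr1 R k.+1).
set m : R := k.+1%:R in k0 *.
set v := (m + 1) `^ al; set u := m `^ al.
pose Q x := v * q (x + 1) - u * q x.
pose Q1 x := v * q1 (x + 1) - u * q1 x.
pose Q2 x := v * q2 (x + 1) - u * q2 x.
have : 0 <= 3 / 2 * Q1 (m + 1) - 1 / 2 * Q1 m - Q (m + 1) + Q m.
  apply: (tilted_mean_ge0 (Q2 := Q2)).
  - move=> x xm; apply: has_derivativeB; apply: has_derivativeZ; last by apply: dq; lra.
    by apply/has_derivative_shift/dq; lra.
  - move=> x xm; apply: has_derivativeB; apply: has_derivativeZ; last by apply: dq1; lra.
    by apply/has_derivative_shift/dq1; lra.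
  - move=> x xm; have x0 : 0 < x by lra.
    have h : u * x `^ (- al) <= v * (x + 1) `^ (- al).
      have x10 : 0 < x + 1 by lra.
      rewrite !powRN ler_pdivrMr ?powR_gt0// mulrAC ler_pdivlMr ?powR_gt0//.
      rewrite -!powRM//; try lra.
      by apply: ge0_ler_powR; rewrite ?nnegrE; nra.
    rewrite /Q2 /q2 [leRHS](_ : _ = (2 - al) * (1 - al) *
      (v * (x + 1) `^ (- al) - u * x `^ (- al))); last by ring.
    by apply: mulr_ge0; rewrite ?subr_ge0//; apply: mulr_ge0; lra.
rewrite /Q /Q1; lra.
Qed.

Lemma coef_a_ni k : - coef_a al k.+2 <= - coef_a al k.+1.
Proof.
have al0 := al_gt0; have al1 := al_lt1.
have k0 : 0 < k.+1%:R :> R by [].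
rewrite !coef_aE -(@natr1 R k.+1).
set m : R := k.+1%:R in k0 *.
pose Q x := q x - q (x + 1).
pose Q1 x := q1 x - q1 (x + 1).
pose Q2 x := q2 x - q2 (x + 1).
have : 0 <= 3 / 2 * Q1 (m + 1) - 1 / 2 * Q1 m - Q (m + 1) + Q m.
  apply: (tilted_mean_ge0 (Q2 := Q2)).
  - move=> x xm; apply: has_derivativeB; first by apply: dq; lra.
    by apply/has_derivative_shift/dq; lra.
  - move=> x xm; apply: has_derivativeB; first by apply: dq1; lra.
    by apply/has_derivative_shift/dq1; lra.
  - move=> x xm; have x0 : 0 < x by lra.
    rewrite /Q2 /q2 subr_ge0; do 2 (apply: ler_wpM2l; first by lra).
    rewrite !powRN lef_pV2 ?posrE ?powR_gt0//; last by lra.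
    by apply: ge0_ler_powR; rewrite ?nnegrE; lra.
rewrite /Q /Q1; lra.
Qed.

End coefficients.

(** * Polynomial bounds for powers of 1/2 and 2/3 *)

Section binomial_bounds.
Context {R : realType}.
Implicit Types (al x y : R).

Let powR_split al y : y < 1 -> (1 - y) `^ (- al) = (1 - y) * (1 - y) `^ (- al - 1).
Proof. by move=> y1; apply: powR_succ; [lra|ring]. Qed.

Let quotient_derivative al (P P1 : R -> R) y : y < 1 -> has_derivative P y (P1 y) ->
  has_derivative (fun t => P t * (1 - t) `^ (- al)) y
    ((1 - y) `^ (- al - 1) * (al * P y + (1 - y) * P1 y)).
Proof.
move=> y1 dP; apply: has_derivative_eq.
  apply: has_derivativeM; first exact: dP.
  apply: (has_derivative_reflect (f := fun t => t `^ (- al))).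
  by apply: has_derivative_powR => //; lra.
by rewrite /= (powR_split al y1); ring.
Qed.

(** The hypothesis says that P (y) (1 - y)^(-al) is nondecreasing.  Along a
truncation of the binomial series of (1 - y)^al all but one monomial of
al P + (1 - y) P' cancel. *)
Lemma onem_powR_le al (P P1 : R -> R) x : 0 <= x < 1 -> P 0 = 1 ->
  (forall y, has_derivative P y (P1 y)) ->
  (forall y, 0 <= y <= x -> 0 <= al * P y + (1 - y) * P1 y) ->
  (1 - x) `^ al <= P x.
Proof.
move=> /andP[x0 x1] P0 dP P_ge.
have h : 1 <= P x * (1 - x) `^ (- al).
  pose f t := P t * (1 - t) `^ (- al).
  suff : f 0 <= f x by rewrite /f P0 subr0 powR1 mulr1.
  apply: (le_of_derivative (f' := fun y =>
    (1 - y) `^ (- al - 1) * (al * P y + (1 - y) * P1 y))) => //.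
    by move=> y xy; apply: quotient_derivative => //; lra.
  by move=> y xy; rewrite mulr_ge0 ?powR_ge0 ?P_ge.
have p0 : 0 < (1 - x) `^ al by rewrite powR_gt0; lra.
by rewrite powRN in h; move: h; rewrite ler_pdivlMr// mul1r.
Qed.

Lemma onem_powR_ge al (P P1 : R -> R) x : 0 <= x < 1 -> P 0 = 1 ->
  (forall y, has_derivative P y (P1 y)) ->
  (forall y, 0 <= y <= x -> al * P y + (1 - y) * P1 y <= 0) ->
  P x <= (1 - x) `^ al.
Proof.
move=> /andP[x0 x1] P0 dP P_le.
have h : P x * (1 - x) `^ (- al) <= 1.
  pose f t := -1 * (P t * (1 - t) `^ (- al)).
  suff : f 0 <= f x by rewrite /f P0 subr0 powR1 !mulN1r mulr1 lerN2.
  apply: (le_of_derivative (f' := fun y =>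
    -1 * ((1 - y) `^ (- al - 1) * (al * P y + (1 - y) * P1 y)))) => //.
    by move=> y xy; apply/has_derivativeZ/quotient_derivative => //; lra.
  move=> y xy; rewrite mulN1r oppr_ge0 mulr_ge0_le0 ?powR_ge0 ?P_le//.
have p0 : 0 < (1 - x) `^ al by rewrite powR_gt0; lra.
by rewrite powRN in h; move: h; rewrite ler_pdivrMr// mul1r.
Qed.

Definition quartic (c1 c2 c3 c4 y : R) : R :=
  1 + y * (c1 + y * (c2 + y * (c3 + y * c4))).

Lemma quartic_derivative c1 c2 c3 c4 y : has_derivative (quartic c1 c2 c3 c4) y
  (c1 + y * (2 * c2 + y * (3 * c3 + y * (4 * c4)))).
Proof.
apply: has_derivative_eq.
  apply: has_derivativeD; first exact: has_derivative_cst.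
  do 3 (apply: has_derivativeM; first exact: has_derivative_id;
    apply: has_derivativeD; first exact: has_derivative_cst).
  apply: has_derivativeM; first exact: has_derivative_id; exact: has_derivative_cst.
by rewrite /=; ring.
Qed.

Let quartic0 c1 c2 c3 c4 : quartic c1 c2 c3 c4 0 = 1.
Proof. by rewrite /quartic mul0r addr0. Qed.

(** Beyond the constant term the binomial series of (1 - x)^al has nonpositive
coefficients, so its truncations are upper bounds; they are exact at al = 0 and
al = 1.  Consecutive terms have a ratio of at most x, hence multiplying the last
term kept by 1 / (1 - x) turns a truncation into a lower bound. *)
Lemma half_powR_le al : 0 <= al <= 1 ->
  (1 / 2) `^ al <= 1 - al / 2 - al * (1 - al) / 8.
Proof.
move=> al01; have -> : 1 / 2 = 1 - 1 / 2 :> R by lra.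
pose c := al * (1 - al) / 2.
have -> : 1 - al / 2 - al * (1 - al) / 8 = quartic (- al) (- c) 0 0 (1 / 2).
  by rewrite /quartic /c; field.
apply: (onem_powR_le _ _ (@quartic_derivative _ _ _ _)) => //; first lra.
move=> y y01; rewrite /quartic.
rewrite [leRHS](_ : _ = (2 - al) * c * y ^+ 2); last by rewrite /c; field.
by rewrite mulr_ge0 ?sqr_ge0// mulr_ge0// /c; nra.
Qed.

Lemma half_powR_ge al : 0 <= al <= 1 ->
  1 - al / 2 - al * (1 - al) / 8 - al * (1 - al) * (2 - al) / 48
    - al * (1 - al) * (2 - al) * (3 - al) / 192 <= (1 / 2) `^ al.
Proof.
move=> al01; have -> : 1 / 2 = 1 - 1 / 2 :> R by lra.
pose c := al * (1 - al) * (2 - al) * (3 - al) / 24.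
rewrite [leLHS](_ : _ = quartic (- al) (- (al * (1 - al) / 2))
  (- (al * (1 - al) * (2 - al) / 6)) (- (2 * c)) (1 / 2)); last first.
  by rewrite /quartic /c; field.
apply: (onem_powR_ge _ _ (@quartic_derivative _ _ _ _)) => //; first lra.
move=> y y01; rewrite /quartic.
rewrite [leLHS](_ : _ = - (c * y ^+ 3 * (4 - 8 * y + 2 * al * y))); last first.
  by rewrite /c; field.
rewrite oppr_le0; apply: mulr_ge0; last by nra.
apply: mulr_ge0; last by rewrite exprn_ge0; lra.
by rewrite /c; do 4 (apply: mulr_ge0; last by lra); lra.
Qed.

Lemma two_thirds_powR_le al : 0 <= al <= 1 ->
  (2 / 3) `^ al <=
  1 - al / 3 - al * (1 - al) / 18 - al * (1 - al) * (2 - al) / 162.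
Proof.
move=> al01; have -> : 2 / 3 = 1 - 1 / 3 :> R by lra.
pose c := al * (1 - al) * (2 - al) / 6.
rewrite [leRHS](_ : _ =
    quartic (- al) (- (al * (1 - al) / 2)) (- c) 0 (1 / 3)); last first.
  by rewrite /quartic /c; field.
apply: (onem_powR_le _ _ (@quartic_derivative _ _ _ _)) => //; first lra.
move=> y y01; rewrite /quartic.
rewrite [leRHS](_ : _ = (3 - al) * c * y ^+ 3); last by rewrite /c; field.
apply: mulr_ge0; last by rewrite exprn_ge0; lra.
apply: mulr_ge0; first lra.
by rewrite /c; do 3 (apply: mulr_ge0; last by lra); lra.
Qed.

Lemma two_thirds_powR_ge al : 0 <= al <= 1 ->
  1 - al / 3 - al * (1 - al) / 12 <= (2 / 3) `^ al.
Proof.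
move=> al01; have -> : 2 / 3 = 1 - 1 / 3 :> R by lra.
pose c := al * (1 - al) / 2.
rewrite [leLHS](_ : _ = quartic (- al) (- (3 / 2 * c)) 0 0 (1 / 3)); last first.
  by rewrite /quartic /c; field.
apply: (onem_powR_ge _ _ (@quartic_derivative _ _ _ _)) => //; first lra.
move=> y y01; rewrite /quartic.
rewrite [leLHS](_ : _ = - (c * y * (1 - 3 * y + 3 / 2 * al * y))); last first.
  by rewrite /c; field.
rewrite oppr_le0; apply: mulr_ge0; last by nra.
by apply: mulr_ge0; last lra; rewrite /c; nra.
Qed.

End binomial_bounds.

(** * The first coefficients *)

Section first_coefficients.
Context {R : realType} (al : R).
Context (al_gt0 : 0 < al) (al_lt1 : al < 1).

Let A : R := (1 / 2) `^ al.
Let G : R := (2 / 3) `^ al.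

Let powRNV (x : R) : 0 < x -> x `^ (- al) = (1 / x) `^ al.
Proof.
move=> x0; have x10 : 0 < 1 / x by rewrite divr_gt0.
apply: (mulfI (x := x `^ al)); first by rewrite gt_eqF// powR_gt0.
rewrite powRN divff ?gt_eqF ?powR_gt0// -powRM ?ltW//.
by rewrite mul1r divff ?gt_eqF// powR1.
Qed.

Let powR1B (x : R) : 0 < x -> x `^ (1 - al) = x * (1 / x) `^ al.
Proof. by move=> x0; rewrite -powRNV//; apply: powR_succ => //; ring. Qed.

Let powR2B (x : R) : 0 < x -> x `^ (2 - al) = x ^+ 2 * (1 / x) `^ al.
Proof.
move=> x0; rewrite expr2 -mulrA -powR1B//; apply: powR_succ => //; ring.
Qed.

Let third : (1 / 3) `^ al = A * G.
Proof. by rewrite /A /G -powRM; try lra; congr (_ `^ _); lra. Qed.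

Let quarter : (1 / 4) `^ al = A ^+ 2.
Proof. by rewrite /A expr2 -powRM; try lra; congr (_ `^ _); lra. Qed.

Lemma coef_d1E : coef_d al 1 = (2 + al) * A - 3 / 2 * al.
Proof.
rewrite /coef_d /coef_c /= !powR1 !powR1B// !powR2B// -/A; by field.
Qed.

Lemma coef_d2E : coef_d al 2 =
  (6 + 3 / 2 * al) * (A * G) - (4 + 2 * al) * A + al / 2.
Proof.
rewrite /coef_d /coef_c /coef_a /= !powR1 !powR1B// !powR2B// third -/A; by field.
Qed.

Lemma coef_d3E : coef_d al 3 =
  (12 + 2 * al) * A ^+ 2 - (12 + 3 * al) * (A * G) + (2 + al) * A.
Proof.
rewrite /coef_d /coef_c /coef_a /= !powR1B// !powR2B// third quarter -/A; by field.
Qed.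

Lemma coef_a1E : - coef_a al 1 = (2 - 3 * al) * A + al / 2.
Proof. rewrite /coef_a !powR1 !powR1B// !powR2B// -/A; by field. Qed.

Let al01 : 0 <= al <= 1. Proof. by rewrite !ltW. Qed.

Let A_gt0 : 0 < A. Proof. by apply: powR_gt0; lra. Qed.

Let A_gt : 1 / 2 <= A.
Proof. by apply: ger1_powR; [lra|exact: ltW]. Qed.

Lemma coef_d1_gt0 : 0 < coef_d al 1.
Proof.
have al0 := al_gt0; have al1 := al_lt1; have A12 := A_gt; rewrite coef_d1E; nra.
Qed.

Lemma coef_a1_bounds : 0 < - coef_a al 1 <= 2 - 2 * al.
Proof.
have al0 := al_gt0; have al1 := al_lt1; have A12 := A_gt; have A0 := A_gt0.
have AE := half_powR_le al01; rewrite -/A in AE.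
have {}AE : A <= 1 - al / 2 by nra.
rewrite coef_a1E; have [h|h] := lerP 0 (2 - 3 * al); apply/andP; split; nra.
Qed.

(** Both sides agree at al = 0 and al = 1, so al (1 - al) can be factored out
of the polynomial left after replacing A and G by their bounds.  The cofactor is
written in the Bernstein basis, where its coefficients are positive.  The next
two lemmas proceed in the same way, the second with the factor 1 - al only. *)
Lemma coef_d2_le : coef_d al 2 <= A * coef_d al 1.
Proof.
have al0 := al_gt0; have al1 := al_lt1; have A0 := A_gt0.
have al_ge0 := ltW al0.
have [b b0 bE] : exists2 b : R, 0 <= b & b = 1 - al by exists (1 - al); lra.
have mono_ge0 i j : 0 <= al ^+ i * b ^+ j by rewrite mulr_ge0 ?exprn_ge0.
have AE := half_powR_ge al01; rewrite -/A in AE.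
have GE := two_thirds_powR_le al01; rewrite -/G in GE.
rewrite coef_d1E coef_d2E -subr_ge0.
have e0 : 0 <= al * (1 - al) by apply: mulr_ge0; lra.
have {}AE : 1 - al / 2 - al * (1 - al) / 4 <= A.
  apply: le_trans AE; move: e0; set e := al * (1 - al) => e0.
  have : 0 <= e * al by rewrite mulr_ge0// ltW.
  have : 0 <= e * al * (1 - al) by rewrite !mulr_ge0//; lra.
  lra.
have {}GE : G <= 1 - al / 3 - al * (1 - al) / 18.
  apply: (le_trans GE); rewrite gerBl.
  by apply: divr_ge0; last lra; apply: mulr_ge0 => //; lra.
set a := 1 - al / 2 - _ in AE; set g := 1 - al / 3 - _ in GE.
have a_gt0 : 0 < a by rewrite /a; nra.
have : 0 <= a * ((2 + al) * a + 4 + al / 2 - (6 + 3 / 2 * al) * g) - al / 2.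
  rewrite [leRHS](_ : _ = al * b * (1 / 3 * b ^+ 3 +
    17 / 24 * al * b ^+ 2 + 1 / 2 * al ^+ 2 * b +
    1 / 12 * al ^+ 3)); last by rewrite /a /g bE; field.
  apply: mulr_ge0; first exact: mulr_ge0.
  have := mono_ge0 0%N 3%N.
  have := mono_ge0 1%N 2%N.
  have := mono_ge0 2%N 1%N.
  have := mono_ge0 3%N 0%N.
  rewrite !(expr0, mul1r, mulr1); lra.
move=> h; apply: (le_trans h).
have g_le : (2 + al) * a + 4 + al / 2 - (6 + 3 / 2 * al) * g <=
  (2 + al) * A + 4 + al / 2 - (6 + 3 / 2 * al) * G by nra.
have inner_ge0 : 0 <= (2 + al) * a + 4 + al / 2 - (6 + 3 / 2 * al) * g.
  rewrite -(pmulr_rge0 _ a_gt0); lra.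
have := ler_pM (ltW a_gt0) inner_ge0 AE g_le; lra.
Qed.

Lemma coef_d3_ge : A * coef_d al 2 <= coef_d al 3.
Proof.
have al0 := al_gt0; have al1 := al_lt1; have A0 := A_gt0.
have al_ge0 := ltW al0.
have [b b0 bE] : exists2 b : R, 0 <= b & b = 1 - al by exists (1 - al); lra.
have mono_ge0 i j : 0 <= al ^+ i * b ^+ j by rewrite mulr_ge0 ?exprn_ge0.
have AE := half_powR_ge al01; rewrite -/A in AE.
have GE := two_thirds_powR_le al01; rewrite -/G in GE.
have G1 : G <= 1 by nra.
(* The difference of the two sides is this quantity times A (2 + al / 2). *)
suff h : 0 <= A * (8 - 3 * G) + 1 - 6 * G.
  rewrite coef_d2E coef_d3E -subr_ge0.
  rewrite [leRHS](_ : _ = A * ((2 + al / 2) * (A * (8 - 3 * G) + 1 - 6 * G))).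
    by rewrite !mulr_ge0//; lra.
  by field.
move: AE GE; set a := (X in X <= A); set g := (X in G <= X) => AE GE.
have : 0 <= a * (8 - 3 * g) + 1 - 6 * g.
  rewrite [leRHS](_ : _ = al * b * (35 / 288 * b ^+ 5 +
    1157 / 2592 * al * b ^+ 4 + 6779 / 10368 * al ^+ 2 * b ^+ 3 +
    2479 / 5184 * al ^+ 3 * b ^+ 2 + 151 / 864 * al ^+ 4 * b +
    11 / 432 * al ^+ 5)); last by rewrite /a /g bE; field.
  apply: mulr_ge0; first exact: mulr_ge0.
  have := mono_ge0 0%N 5%N.
  have := mono_ge0 1%N 4%N.
  have := mono_ge0 2%N 3%N.
  have := mono_ge0 3%N 2%N.
  have := mono_ge0 4%N 1%N.
  have := mono_ge0 5%N 0%N.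
  rewrite !(expr0, mul1r, mulr1); lra.
have a0 : 0 <= a by rewrite /a; nra.
move: AE GE a0; clearbody a g => AE GE a0 h.
have : a * (8 - 3 * G) <= A * (8 - 3 * G) by rewrite ler_wpM2r//; lra.
have : a * G <= a * g by rewrite ler_wpM2l.
lra.
Qed.

Lemma coef_d1_le : coef_d al 1 <= 14 / 3 * coef_d al 2.
Proof.
have al0 := al_gt0; have al1 := al_lt1; have A0 := A_gt0.
have al_ge0 := ltW al0.
have [b b0 bE] : exists2 b : R, 0 <= b & b = 1 - al by exists (1 - al); lra.
have mono_ge0 i j : 0 <= al ^+ i * b ^+ j by rewrite mulr_ge0 ?exprn_ge0.
have AE := half_powR_le al01; rewrite -/A in AE.
have GE := two_thirds_powR_ge al01; rewrite -/G in GE.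
suff h : 0 <= A * ((84 + 21 * al) * G - (62 + 31 * al)) + 23 / 2 * al.
  rewrite coef_d1E coef_d2E; lra.
have [h|h] := lerP 0 ((84 + 21 * al) * G - (62 + 31 * al)).
  by rewrite addr_ge0 ?mulr_ge0//; lra.
move: AE GE; set a := (X in A <= X); set g := (X in X <= G) => AE GE.
have : 0 <= a * ((84 + 21 * al) * g - (62 + 31 * al)) + 23 / 2 * al.
  rewrite [leRHS](_ : _ = b * (22 * b ^+ 4 +
    251 / 4 * al * b ^+ 3 + 481 / 8 * al ^+ 2 * b ^+ 2 +
    675 / 32 * al ^+ 3 * b + 3 / 2 * al ^+ 4)); last first.
    by rewrite /a /g bE; field.
  apply: mulr_ge0; first exact: b0.
  have := mono_ge0 0%N 4%N.
  have := mono_ge0 1%N 3%N.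
  have := mono_ge0 2%N 2%N.
  have := mono_ge0 3%N 1%N.
  have := mono_ge0 4%N 0%N.
  rewrite !(expr0, mul1r, mulr1); lra.
have a0 : 0 < a by apply: lt_le_trans AE.
move: AE GE a0; clearbody a g => AE GE a0 h'.
have : a * ((84 + 21 * al) * g) <= a * ((84 + 21 * al) * G).
  by rewrite !ler_pM2l//; lra.
have : a * ((84 + 21 * al) * G - (62 + 31 * al)) <=
    A * ((84 + 21 * al) * G - (62 + 31 * al)).
  by rewrite ler_nM2r.
lra.
Qed.

End first_coefficients.

(** * The coefficient sequences *)

Section coefficient_sequences.
Context {R : realType} (al : R).
Context (al_gt0 : 0 < al) (al_lt1 : al < 1).

(** The coefficients of indices i + 1; [seq_g] is the coefficient of the first
difference quotient in the history sum, namely d - c. *)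
Definition seq_d (i : nat) : R := coef_d al i.+1.
Definition seq_g (i : nat) : R := if i is 0 then 2 - 2 * al else - coef_a al i.

Lemma coef_d_logconvex_step k : 0 < coef_d al k.+2 ->
  coef_d al k.+3 ^+ 2 <= coef_d al k.+2 * coef_d al k.+4.
Proof.
move=> d0; have := coef_d_quadratic_ge0 al_gt0 al_lt1 k (coef_d al k.+3 / coef_d al k.+2).
set x := coef_d al k.+2 in d0 *; set y := coef_d al k.+3; set z := coef_d al k.+4.
have -> : (y / x) ^+ 2 * x - 2 * (y / x) * y + z = z - y ^+ 2 / x.
  by field; rewrite gt_eqF.
by rewrite subr_ge0 ler_pdivrMr// mulrC.
Qed.

Lemma seq_d_gt0 i : 0 < seq_d i.
Proof.
have d1 := coef_d1_gt0 al_gt0 al_lt1.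
have d2 : 0 < coef_d al 2 by have := coef_d1_le al_gt0 al_lt1; lra.
have d3 : 0 < coef_d al 3.
  by apply: lt_le_trans (coef_d3_ge al_gt0 al_lt1); rewrite mulr_gt0// powR_gt0//; lra.
case: i => [//|i]; rewrite /seq_d.
suff : 0 < coef_d al i.+2 /\ 0 < coef_d al i.+3 by case.
elim: i => [//|i [di dS]]; split=> //.
have := coef_d_logconvex_step di; rewrite -(pmulr_rgt0 _ di).
by apply: lt_le_trans; rewrite exprn_gt0.
Qed.

Lemma seq_d_logconvex i : seq_d i.+1 ^+ 2 <= seq_d i * seq_d i.+2.
Proof.
have d_gt0 := seq_d_gt0; case: i => [|i]; last exact: coef_d_logconvex_step (d_gt0 i.+1).
have h1 := coef_d2_le al_gt0 al_lt1.
have h2 := coef_d3_ge al_gt0 al_lt1.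
have d1 := d_gt0 0%N; have d2 := d_gt0 1%N; rewrite /seq_d in d1 d2 *.
set A := (1 / 2) `^ al in h1 h2.
have : coef_d al 1 * (A * coef_d al 2) <= coef_d al 1 * coef_d al 3.
  by rewrite ler_pM2l.
by apply: le_trans; rewrite expr2 mulrA ler_pM2r// mulrC.
Qed.

Lemma seq_d_le i : seq_d i <= 14 / 3 * seq_d i.+1.
Proof.
elim: i => [|i IHi]; first exact: coef_d1_le.
have d_gt0 := seq_d_gt0.
have : seq_d i * seq_d i.+2 <= 14 / 3 * seq_d i.+1 * seq_d i.+2.
  by rewrite ler_pM2r.
move=> /(le_trans (seq_d_logconvex i)).
by rewrite expr2 mulrAC ler_pM2r.
Qed.

Lemma seq_g_gt0 i : 0 < seq_g i.
Proof.
have al1 := al_lt1; case: i => [|i]; first by rewrite /seq_g; lra.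
elim: i => [|i IHi]; first by have /andP[] := coef_a1_bounds al_gt0 al_lt1.
have := coef_a_scaled_le al_gt0 al_lt1 i.
rewrite -(pmulr_rgt0 _ (powR_gt0 al (ltr0Sn R i.+1))); apply: lt_le_trans.
by rewrite mulr_gt0// powR_gt0.
Qed.

Lemma seq_g_ni i : seq_g i.+1 <= seq_g i.
Proof.
case: i => [|i]; last exact: coef_a_ni.
by have /andP[] := coef_a1_bounds al_gt0 al_lt1.
Qed.

Lemma seq_g_le_d i : seq_g i <= seq_d i.
Proof.
have := coef_c_ge0 al_gt0 al_lt1 i; rewrite /seq_g /seq_d /coef_d.
by case: i => [|i] /=; lra.
Qed.

Lemma seq_dg_ratio i : seq_d i.+1 * seq_g i.+1 <= seq_d i * seq_g i.+2.
Proof.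
have hg := coef_a_scaled_le al_gt0 al_lt1 i.
have hd : i.+2%:R `^ al * seq_d i.+1 <= i.+1%:R `^ al * seq_d i.
  case: i {hg} => [|i]; last exact: coef_d_scaled_le.
  have := coef_d2_le al_gt0 al_lt1; rewrite powR1 mul1r /seq_d.
  have p2 : 0 < 2 `^ al :> R by apply: powR_gt0.
  rewrite -(ler_pM2l p2) => /le_trans; apply; rewrite mulrA -powRM; try lra.
  by rewrite mul1r divff// powR1 mul1r.
have p1 : 0 < i.+1%:R `^ al :> R by apply: powR_gt0.
have p2 : 0 < i.+2%:R `^ al :> R by apply: powR_gt0.
have p : 0 < i.+2%:R `^ al * i.+1%:R `^ al :> R by rewrite mulr_gt0.
rewrite -(ler_pM2l p).
have := ler_pM _ _ hd hg; rewrite !mulr_ge0 ?(ltW p1) ?(ltW p2)//.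
- move=> /(_ isT isT); rewrite /= => h.
  rewrite [leLHS](_ : _ = i.+2%:R `^ al * seq_d i.+1 *
    (i.+1%:R `^ al * - coef_a al i.+1)); last by rewrite /=; ring.
  by apply: (le_trans h); rewrite /=; lra.
- exact: ltW (seq_g_gt0 i.+1).
- exact: ltW (seq_d_gt0 _).
Qed.

End coefficient_sequences.

(** * The functional equation of Gamma *)

Section gamma.
Context {R : realType}.
Implicit Types (z t : R).
Notation mu := (@lebesgue_measure R).

Definition gamma_integrand z t : R := t `^ (z - 1) * expR (- t).

(** An upper bound of t^z e^(-t) for 1 < z <= 2; the constant 8 comes from
1 + s^2 / 2 <= e^s at s = t / 2. *)
Let damp t : R := 8 * expR (- (1 / 2) * t).
Let damp_prim t : R := - 16 * expR (- (1 / 2) * t).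
Let h z t : R := z * gamma_integrand z t - gamma_integrand (z + 1) t + damp t.
Let h_prim z t : R := gamma_integrand (z + 1) t + damp_prim t.

Let gamma_le_damp z t : 1 < z <= 2 -> 0 <= t -> gamma_integrand (z + 1) t <= damp t.
Proof.
move=> /andP[z1 z2] t0; rewrite /gamma_integrand /damp addrK.
have -> : - t = - (1 / 2) * t + - (1 / 2) * t by field.
rewrite expRD mulrA ler_wpM2r ?expR_ge0//.
rewrite -(ler_pM2r (expR_gt0 (t / 2))) -mulrA -expRD.
have -> : - (1 / 2) * t + t / 2 = 0 by field.
rewrite expR0 mulr1.
have hexp : 8 + t ^+ 2 <= 8 * expR (t / 2).
  have := @expR_ge1Dxn R (t / 2) 1 (divr_ge0 t0 (ler0n _ 2)).
  by rewrite [X in _ / X](_ : _ = 2)//; nra.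
apply: le_trans hexp; have [t1|t1] := lerP t 1.
  have : t `^ z <= 1 `^ z by apply: ge0_ler_powR; rewrite ?nnegrE//; lra.
  rewrite powR1; nra.
have : t `^ z <= t `^ 2%:R by apply: ler_powR => //; exact: ltW.
rewrite powR_mulrn//; lra.
Qed.

Let expR_linear_derivative c t :
  has_derivative (fun t => expR (c * t)) t (expR (c * t) * c).
Proof.
apply: has_derivative_eq.
  apply: (has_derivative_comp (f := expR) (g := fun t => c * t)).
  - exact: is_derive_expR.
  - by apply: has_derivativeZ; exact: has_derivative_id.
by rewrite mulr1.
Qed.

Let damp_prim_derivative t : has_derivative damp_prim t (damp t).
Proof.
apply: has_derivative_eq; first by apply: has_derivativeZ; exact: expR_linear_derivative.
by rewrite /damp; field.
Qed.

Let gamma_derivative z t : 0 < t -> has_derivative (gamma_integrand (z + 1)) t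
  (z * gamma_integrand z t - gamma_integrand (z + 1) t).
Proof.
move=> t0; rewrite /gamma_integrand addrK.
under eq_fun do rewrite -mulN1r.
apply: has_derivative_eq.
  apply: has_derivativeM; first exact: has_derivative_powR.
  exact: expR_linear_derivative.
by rewrite /= mulN1r; ring.
Qed.

Let h_prim_derivative z t : 0 < t -> has_derivative (h_prim z) t (h z t).
Proof.
by move=> t0; apply: has_derivativeD; [exact: gamma_derivative|exact: damp_prim_derivative].
Qed.

Let h_ge0 z t : 1 < z <= 2 -> 0 <= t -> 0 <= h z t.
Proof.
move=> z12 t0; rewrite /h -addrA addr_ge0//.
  by rewrite !mulr_ge0 ?powR_ge0 ?expR_ge0//; lra.
by rewrite addrC subr_ge0 gamma_le_damp.
Qed.

Let damp_continuous : continuous damp.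
Proof.
move=> t; apply/differentiable_continuous/derivable1_diffP.
have [] // := has_derivativeZ 8 (expR_linear_derivative (- (1 / 2)) t).
Qed.

Let damp_prim_continuous : continuous damp_prim.
Proof.
move=> t; apply/differentiable_continuous/derivable1_diffP.
by have [] := damp_prim_derivative t.
Qed.

Let has_derivative_continuous (f : R -> R) t l :
  has_derivative f t l -> {for t, continuous f}.
Proof.
by move=> [df _]; apply/differentiable_continuous/derivable1_diffP.
Qed.

Let gamma_continuous z t : 0 < t -> {for t, continuous (gamma_integrand z)}.
Proof.
move=> t0; have := gamma_derivative (z - 1) t0; rewrite subrK.
exact: has_derivative_continuous.
Qed.

Let gamma_cvg0 z : 1 < z ->
  gamma_integrand z x @[x --> 0^'+] --> gamma_integrand z 0.
Proof.
move=> z1; rewrite /gamma_integrand; apply: cvgM.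
  rewrite powR0; first by apply: powR_cvg0; lra.
  by rewrite subr_eq0 gt_eqF.
apply/cvg_at_right_filter; apply: continuous_comp; first exact: opp_continuous.
exact: continuous_expR.
Qed.

Let h_continuous z : 1 < z -> {within `[0, +oo[, continuous (h z)}.
Proof.
move=> z1; apply/continuous_within_itvcyP; split.
  move=> x; rewrite in_itv/= andbT => x0; apply: cvgD; last exact: damp_continuous.
  apply: cvgB; last exact: gamma_continuous.
  by apply: cvgM; [exact: cvg_cst|exact: gamma_continuous].
apply: cvgD; last by apply/cvg_at_right_filter; exact: damp_continuous.
apply: cvgB; last by apply: gamma_cvg0; lra.
by apply: cvgM; [exact: cvg_cst|exact: gamma_cvg0].
Qed.

Let damp_prim_cvgy : damp_prim x @[x --> +oo%R] --> 0.
Proof.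
rewrite -(mulr0 (- 16)); apply: cvgM; first exact: cvg_cst.
rewrite (_ : (fun x => expR (- (1 / 2) * x)) =
             (fun z => expR (- z)) \o (fun z => 1 / 2 * z)); last first.
  by apply: eq_fun => x; rewrite mulNr.
apply: (@cvg_comp _ _ _ _ _ _ (pinfty_nbhs R)); last exact: cvgr_expR.
by apply: gt0_cvgMry => //; rewrite divr_gt0.
Qed.

Let damp_cvgy : damp x @[x --> +oo%R] --> 0.
Proof.
rewrite (_ : damp = fun x => - (1 / 2) * damp_prim x); last first.
  by apply/funext => x; rewrite /damp /damp_prim; field.
by rewrite -(mulr0 (- (1 / 2))); apply: cvgM; [exact: cvg_cst|].
Qed.

Let gamma_cvgy z : 1 < z <= 2 -> gamma_integrand (z + 1) x @[x --> +oo%R] --> 0.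
Proof.
move=> z12; apply: (@squeeze_cvgr _ _ _ _ (fun=> 0) damp) => //.
- near=> x; apply/andP; split.
    by rewrite mulr_ge0 ?powR_ge0 ?expR_ge0.
  by apply: gamma_le_damp => //; near: x; exact: nbhs_pinfty_ge.
- exact: cvg_cst.
Unshelve. all: by end_near. Qed.

Let integral_damp : (\int[mu]_(t in `[0%R, +oo[) (damp t)%:E = 16%:E)%E.
Proof.
rewrite (@ge0_continuous_FTC2y _ damp damp_prim 0 0) //.
- by rewrite /damp_prim mulr0 expR0 mulr1 EFinN oppeK add0e.
- by move=> x _; rewrite mulr_ge0 ?expR_ge0.
- exact: continuous_subspaceT damp_continuous.
- by apply/cvg_at_right_filter; exact: damp_prim_continuous.
- by move=> x _; rewrite derive1E; have [] := damp_prim_derivative x.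
Qed.

Let integral_h z : 1 < z <= 2 ->
  (\int[mu]_(t in `[0%R, +oo[) (h z t)%:E = 16%:E)%E.
Proof.
move=> /[dup] z12 /andP[z1 z2].
rewrite (@ge0_continuous_FTC2y _ (h z) (h_prim z) 0 0) //.
- have -> : h_prim z 0 = - 16.
    rewrite /h_prim /gamma_integrand addrK powR0; last by rewrite gt_eqF//; lra.
    by rewrite mul0r add0r /damp_prim mulr0 expR0 mulr1.
  by rewrite EFinN oppeK add0e.
- by move=> x x0; exact: h_ge0.
- exact: h_continuous.
- by rewrite -(addr0 0); apply: cvgD; [exact: gamma_cvgy|exact: damp_prim_cvgy].
- by move=> x x0; have [] := h_prim_derivative z x0.
- apply: cvgD; last by apply/cvg_at_right_filter; exact: damp_prim_continuous.
  by apply: gamma_cvg0; lra.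
- move=> x; rewrite in_itv/= andbT => x0.
  by rewrite derive1E; have [] := h_prim_derivative z x0.
Qed.

Let gamma_measurable z : 1 < z ->
  measurable_fun `](0 : R), +oo[ (gamma_integrand z).
Proof.
move=> z1; apply: open_continuous_measurable_fun => //.
by move=> x; rewrite inE/= in_itv/= andbT; exact: gamma_continuous.
Qed.

Let gamma_measurable_cbnd z : 1 < z ->
  measurable_fun `[(0 : R), +oo[ (gamma_integrand z).
Proof.
by move=> z1; apply/measurable_fun_itv_obnd_cbndP; exact: gamma_measurable.
Qed.

Lemma Gamma_ge0 z : 0 <= Gamma z :> R.
Proof.
by apply: Rintegral_ge0 => t _; rewrite mulr_ge0 ?powR_ge0 ?expR_ge0.
Qed.

(** The integral of (t^z e^(-t))' = z t^(z-1) e^(-t) - t^z e^(-t) vanishes, but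
this function changes sign.  Adding 8 e^(-t/2) makes it nonnegative, so that
[ge0_continuous_FTC2y] applies; the added integral, 16, cancels in the end, and
no integrability has to be known beforehand. *)
Lemma Gamma_succ z : 1 < z <= 2 -> Gamma (z + 1) = z * Gamma z.
Proof.
move=> /[dup] z12 /andP[z1 z2].
pose I w := (\int[mu]_(t in `[0%R, +oo[) (gamma_integrand w t)%:E)%E.
have GI w : 1 < w -> Gamma w = fine (I w).
  move=> w1; rewrite /Gamma /Rintegral /I integral_itv_obnd_cbnd//.
  by apply/measurable_EFinP; exact: gamma_measurable w1.
have gamma_ge0 w t : 0 <= gamma_integrand w t.
  by rewrite mulr_ge0 ?powR_ge0 ?expR_ge0.
have I_ge0 w : (0 <= I w)%E by apply: integral_ge0 => t _; rewrite lee_fin.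
have mdamp : measurable_fun `[(0 : R), +oo[ damp.
  apply: measurable_funTS.
  exact: continuous_measurable_fun damp_continuous.
have damp_ge0 t : 0 <= damp t by rewrite mulr_ge0 ?expR_ge0.
have mh : measurable_fun `[(0 : R), +oo[ (h z).
  apply: subspace_continuous_measurable_fun => //.
  exact: h_continuous.
have E : (z%:E * I z + 16%:E = 16%:E + I (z + 1)%R)%E.
  have mg := gamma_measurable_cbnd z1.
  have mg1 : measurable_fun `[(0 : R), +oo[ (gamma_integrand (z + 1)).
    by apply: gamma_measurable_cbnd; lra.
  rewrite -{1}integral_damp -(integral_h z12) /I.
  rewrite -ge0_integralZl_EFin//; last 3 first.
  - by move=> t _; rewrite lee_fin.
  - exact/measurable_EFinP.
  - by lra.
  rewrite -!ge0_integralD//.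
  - apply: eq_integral => t _; rewrite -EFinM -!EFinD; congr EFin.
    by rewrite /h; ring.
  - by move=> t; rewrite /= in_itv/= andbT lee_fin => /(h_ge0 z12).
  - exact/measurable_EFinP.
  - by move=> t _; rewrite lee_fin.
  - exact/measurable_EFinP.
  - by move=> t _; rewrite -EFinM lee_fin mulr_ge0//; lra.
  - by apply/measurable_EFinP; exact: measurable_funM.
  - by move=> t _; rewrite lee_fin.
  - exact/measurable_EFinP.
rewrite !GI//; last by lra.
move: E (I_ge0 z) (I_ge0 (z + 1)).
have z0 : 0 < z by lra.
case: (I z) => [x| |] //; case: (I (z + 1)) => [y| |] //=.
- by move=> [] xy _ _; lra.
- by rewrite gt0_muley ?lte_fin.
- by rewrite mulr0.
Qed.

End gamma.

(** * The inner product as a bilinear form *)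

Section L2_form.
Context (R : realType) (m : nat) (Omega : boundedDomain R m).
Implicit Types (u v w : L2 Omega) (a : R).
Notation mu := (domain_measure Omega).
Notation fct u := (u : LfunType mu (lee1n 2)).

Lemma L2innerC u v : L2inner u v = L2inner v u.
Proof. by apply: eq_Rintegral => x _; rewrite mulrC. Qed.

Lemma L2inner_ge0 u : 0 <= L2inner u u.
Proof. by apply: Rintegral_ge0 => x _; rewrite -expr2 sqr_ge0. Qed.

Lemma L2_mul_integrable u v :
  mu.-integrable setT (EFin \o (fun x => fct u x * fct v x)).
Proof.
apply/Lfun1_integrable; exact: (Lfun2_mul_Lfun1 (LfunP (fct u)) (LfunP (fct v))).
Qed.

Lemma L2inner_linear a u v w :
  L2inner (a *: u + v) w = a * L2inner u w + L2inner v w.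
Proof.
have uw := L2_mul_integrable u w; have vw := L2_mul_integrable v w.
have auw := L2_mul_integrable (a *: u) w.
rewrite /L2inner -RintegralZl//.
rewrite (_ : \int[mu]_x (a * _) = \int[mu]_x (fct (a *: u) x * fct w x)); last first.
  by apply: eq_Rintegral => x _ /=; rewrite mulrA.
by rewrite -RintegralD//; apply: eq_Rintegral => x _ /=; rewrite -mulrDl.
Qed.

Lemma L2norm_sqr u : L2norm u ^+ 2 = L2inner u u.
Proof.
have L0 : 0 <= L2norm u by rewrite fine_ge0// Lnorm_ge0.
rewrite -powR_mulrn// /L2norm -fine_poweR poweR_Lnorm//.
congr fine; apply: eq_integral => x _ /=.
by rewrite powR_mulrn// real_normK ?num_real// expr2.
Qed.

End L2_form.

(** * The operator in terms of difference quotients *)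

Section representation.
Context {R : realType} (V : lmodType R) (al dt : R) (u : nat -> V).
Context (al_gt0 : 0 < al) (al_lt1 : al < 1) (dt_gt0 : 0 < dt).
Let v i : V := diffq dt u i.+1.

(** A second-order stencil that kills constants is a combination of the two
difference quotients it spans. *)
Lemma three_point (a b c : R) i : a + b + c = 0 ->
  a *: u i + b *: u i.+1 + c *: u i.+2 = dt *: (c *: v i.+1 - a *: v i).
Proof.
move=> abc; have {abc}-> : b = - a - c by lra.
have dtv j : dt *: v j = u j.+1 - u j.
  by rewrite /v /diffq subn1 scalerA divff ?scale1r// gt_eqF.
rewrite scalerBr !scalerA !(mulrC dt) -!scalerA !dtv !scalerBr opprB.
by rewrite scalerBl scaleNr !addrA (ACl (4*3*1*2)%AC).
Qed.

Let kappa := dt `^ (1 - al) / Gamma (3 - al).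

Lemma Lalpha_scale : (Gamma (3 - al) * dt `^ al)^-1 * dt = kappa.
Proof.
rewrite /kappa powRB ?(gt_eqF dt_gt0) ?implybT// powRr1 ?ltW// invfM; ring.
Qed.

Lemma Lalpha_first :
  Lalpha al dt u 1 = kappa *: (seq_g al 0 *: v 0%N + al *: v 0%N).
Proof.
rewrite /Lalpha /= -scalerDl scalerA /seq_g.
have -> : 2 - 2 * al + al = 2 - al by ring.
have dtv : u 1%N - u 0%N = dt *: v 0%N.
  by rewrite /v /diffq scalerA divff ?scale1r// gt_eqF.
rewrite dtv scalerA; congr (_ *: _).
have z12 : 1 < 2 - al <= 2 by apply/andP; split; move: al_gt0 al_lt1; lra.
have : Gamma (3 - al) = (2 - al) * Gamma (2 - al) :> R.
  by rewrite -Gamma_succ//; congr Gamma; ring.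
rewrite -Lalpha_scale => ->; rewrite !invfM.
have z0 : 2 - al != 0 by apply/eqP; move: al_lt1; lra.
by rewrite -!mulrA [RHS](_ : _ = (2 - al)^-1 * (2 - al) * ((Gamma (2 - al))^-1 *
  ((dt `^ al)^-1 * dt))); [rewrite mulVf// mul1r|ring].
Qed.

(** The stencil of index j in the history sum has coefficients a_j, b_j, c_j with
a_j + b_j + c_j = 0, and so has the local stencil.  Collecting the coefficient of
each difference quotient produces c_j - a_(j-1) = d_j. *)
Lemma Lalpha_later k : Lalpha al dt u k.+2 = kappa *:
  ((3 / 2 * al) *: v k.+1 - (al / 2) *: v k +
   \sum_(j < k.+2) history_kernel (seq_d al) (seq_g al) k.+1 j *: v j).
Proof.
rewrite /Lalpha (_ : (k.+2 == 1)%N = false)// -Lalpha_scale -(scalerA _ dt); congr (_ *: _).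
rewrite big_nat_rev big_add1 big_mkord.
rewrite (eq_bigr (fun i : 'I_k.+1 => dt *: (coef_c al (k.+1 - i) *: v i.+1
    - coef_a al (k.+1 - i) *: v i))); last first.
  move=> [i /= ik] _.
  have -> : (1 + k.+2 - i.+2 = k.+1 - i)%N by lia.
  have -> : (k.+2 - (k.+1 - i) - 1 = i)%N by lia.
  have -> : (k.+2 - (k.+1 - i) = i.+1)%N by lia.
  rewrite addn1; apply: three_point.
  by rewrite /coef_a /coef_b /coef_c; field.
rewrite -scaler_sumr -addrA -addrA (addrA ((al / 2) *: _)).
rewrite subn2 subn1 /= -scaleNr three_point; last by field.
rewrite -scalerDr; congr (_ *: _).
rewrite sumrB big_ord_recr/= [X in _ - X]big_ord_recl/= subn0 subSnn.
rewrite [in RHS]big_ord_recl [in RHS]big_ord_recr/=.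
rewrite [in RHS](eq_bigr (fun i : 'I_k => coef_c al (k.+1 - i) *: v i.+1 -
  coef_a al (k.+1 - bump 0 i) *: v (bump 0 i))); last first.
  move=> [i /= ik] _; rewrite /bump /= !add1n !subSS /seq_d.
  rewrite -scalerBl; congr (_ *: _).
  rewrite /coef_d (subSn (ltnW ik)) ifF//; apply/eqP; lia.
rewrite sumrB /bump /= !add1n subnn /seq_d /coef_d /= scaleNr opprD !addrA.
set P := \sum_(i < k) coef_c al _ *: _; set Q := \sum_(i < k) coef_a al _ *: _.
rewrite [LHS](ACl (1*3*4*6*(2*5))%AC) [RHS](ACl (4*3*5*2*(6*1))%AC)/=.
by rewrite -!scalerDl; congr (_ + _ *: _); field.
Qed.

End representation.

(** * The energy inequality *)

Theorem lemma2p3 (R : realType) (m : nat) (m_gt0 : (0 < m)%N)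
    (Omega : boundedDomain R m) (al : R) (al_gt0 : 0 < al) (al_lt1 : al < 1)
    (T : R) (T_gt0 : 0 < T) (N : nat) (N_ge1 : (1 <= N)%N)
    (u : R -> L2 Omega) (u_cont : L2_continuous_on `[0, T]%classic u)
    (n : nat) (n_ge1 : (1 <= n)%N) (n_leN : (n <= N)%N) :
  let dt := T / N%:R in
  let uk := fun k : nat => u (k%:R * dt) in
  let rhs := 5 * al * dt `^ (1 - al) / (12 * Gamma (3 - al)) *
    \sum_(1 <= k < n.+1)
      coef_d al (n - k + 1) * L2norm (diffq dt uk k) ^+ 2 in
  \sum_(1 <= k < n.+1)
    coef_d al (n - k + 1) * L2inner (Lalpha al dt uk k) (diffq dt uk k) >= rhs
  /\ rhs >= 0.
Proof.
move=> dt uk; case: n n_ge1 n_leN => [//|p] _ _ rhs.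
have dt_gt0 : 0 < dt by rewrite divr_gt0// ltr0n.
pose kappa := dt `^ (1 - al) / Gamma (3 - al).
pose v i := diffq dt uk i.+1.
pose M i := if i is k.+1 then (3 / 2 * al) *: v k.+1 - (al / 2) *: v k +
    \sum_(j < k.+2) history_kernel (seq_d al) (seq_g al) k.+1 j *: v j
  else seq_g al 0 *: v 0%N + al *: v 0%N.
have kappa_ge0 : 0 <= kappa by rewrite divr_ge0 ?powR_ge0 ?Gamma_ge0.
have LM i : Lalpha al dt uk i.+1 = kappa *: M i.
  by case: i => [|k]; [exact: Lalpha_first|exact: Lalpha_later].
have energy : 5 / 12 * al *
    (\sum_(k < p.+1) seq_d al (p - k) * L2inner (v k) (v k)) <=
    \sum_(k < p.+1) seq_d al (p - k) * L2inner (M k) (v k).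
  apply: (weighted_energy (@L2innerC _ _ _) (@L2inner_linear _ _ _)
    (@L2inner_ge0 _ _ _) (seq_d_gt0 al_gt0 al_lt1) (seq_g_gt0 al_gt0 al_lt1)
    (seq_g_le_d al_gt0 al_lt1) (seq_g_ni al_gt0 al_lt1)
    (seq_d_logconvex al_gt0 al_lt1) (seq_dg_ratio al_gt0 al_lt1)
    (seq_d_le al_gt0 al_lt1) (ltW al_gt0)) => // k _.
have rhsE : rhs = kappa * (5 / 12 * al *
    \sum_(k < p.+1) seq_d al (p - k) * L2inner (v k) (v k)).
  rewrite /rhs /kappa big_add1 big_mkord mulrA; congr (_ * _).
    by rewrite !invfM; ring.
  by apply: eq_bigr => k _; rewrite L2norm_sqr subSS addn1.
split; last first.
  rewrite rhsE; apply: mulr_ge0 => //; apply: mulr_ge0; first by lra.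
  apply: sumr_ge0 => k _.
  by rewrite mulr_ge0 ?L2inner_ge0// ltW// seq_d_gt0.
rewrite rhsE big_add1 big_mkord (le_trans (ler_wpM2l kappa_ge0 energy))//.
rewrite mulr_sumr le_eqVlt; apply/orP; left; apply/eqP/eq_bigr => k _.
by rewrite LM subSS addn1 (form_scalel (@L2inner_linear _ _ _)) mulrCA.
Qed.
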